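(* Let $A(\mathbb{E})=\Bbbk\langle v_1,\dots,v_N\rangle/(\sum_{1\le i,j\le N}e_{ij}v_iv_j)$ with $N\ge 2$ and $\mathbb{E}=(e_{ij})\in GL_N(\Bbbk)$, an Artin–Schelter regular algebra of global dimension $2$. Let $H$ be a Hopf algebra with antipode of finite order, coacting on $A(\mathbb{E})$ from the right, inner-faithfully and preserving the grading, with homological codeterminant $\mathsf{D}\in H$. Suppose that $\mathbb{E}$ is congruent to a matrix of one of the forms $$( * )\qquad \mathbb{J}_n\oplus\mathbb{D}_{2r_1}(q_1)\oplus\cdots\oplus\mathbb{D}_{2r_s}(q_s)\quad\text{or}\quad \mathbb{D}_{2r_1}(q_1)\oplus\cdots\oplus\mathbb{D}_{2r_s}(q_s),$$ with $q_i\neq 0,(-1)^{r_i+1}$ for all $i$, and that one of the following conditions holds: (i) the numbers $q_1,q_1^{-1},q_2,q_2^{-1},\dots,q_s,q_s^{-1}$ are pairwise distinct, $H$ is involutory (the square of its antipode is the identity), and $\mathsf{D}$ is central in $H$; or (ii) for every integer $e\ge1$ the numbers $q_1^{e},q_1^{-e},\dots,q_s^{e},q_s^{-e}$ are pairwise distinct, and $\mathsf{D}^m$ is central in $H$ for some $m\ge1$. Then $H$ is cocommutative. If, further, $H$ is finite dimensional, then $H$ must be a group algebra.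
   Context: $\Bbbk$ is an algebraically closed field of characteristic zero. Two matrices $\mathbb{E},\mathbb{E}'$ are congruent if $\mathbb{E}'=\mathbb{P}^T\mathbb{E}\mathbb{P}$ for some invertible $\mathbb{P}$. In $( * )$ the number $s$ of summands $\mathbb{D}_{2r_i}(q_i)$ may be $0$ in the first form. $\mathbb{J}_n$ is the $n\times n$ matrix with entries $(\mathbb{J}_n)_{i,n+1-i}=(-1)^{n-i}$ for $1\le i\le n$, $(\mathbb{J}_n)_{i,n+2-i}=(-1)^{n-i}$ for $2\le i\le n$, and $0$ elsewhere (so $\mathbb{J}_1=(1)$). $\mathbb{B}_r(q)$ is the $r\times r$ matrix with $q$ on the diagonal, $1$ on the superdiagonal, $0$ elsewhere; $\mathbb{D}_{2r}(q)=\begin{pmatrix}0&\mathbb{I}_r\\ \mathbb{B}_r(q)&0\end{pmatrix}$. $H$ coacts on $A=A(\mathbb{E})$ if $A$ is a right $H$-comodule algebra, via $\rho:A\to A\otimes H$; since $\rho$ preserves the grading, it is induced by a coaction on the free algebra $\Bbbk\langle v_1,\dots,v_N\rangle$. It is inner-faithful if $\rho(A)\not\subset A\otimes H'$ for every proper Hopf subalgebra $H'\subsetneq H$. The homological codeterminant is the group-like element $\mathsf{D}\in H$ with $\rho(r)=r\otimes\mathsf{D}^{-1}$, where $r=\sum e_{ij}v_iv_j$ and $\rho$ is the coaction on the free algebra. *)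

(* Defs.v *)
Set Warnings "-notation-overridden,-ambiguous-paths".
Set Warnings "-notation-incompatible-prefix,-redundant-canonical-projection".
From HB Require Import structures.
From mathcomp Require Import all_boot all_order all_fingroup all_algebra.
From mathcomp Require Import generic_quotient ring_quotient.
From mathcomp Require Import finmap monalg.
From mathcomp Require Import boolp classical_sets.

Set Implicit Arguments.
Unset Strict Implicit.
Unset Printing Implicit Defensive.

Import GRing.Theory.
Local Open Scope ring_scope.
Local Open Scope quotient_scope.
Local Open Scope classical_set_scope.

Section Span.
Variables (R : nzRingType) (M : lmodType R).

Definition lin_span (S : set M) : {pred M} := fun x =>
  `[< exists s : seq (R * M),
        (forall p, p \in s -> S p.2) /\ x = \sum_(p <- s) p.1 *: p.2 >].

Variable S : set M.

Lemma lin_span_gen x : S x -> x \in lin_span S.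
Proof.
move=> Sx; apply/asboolP; exists [:: (1, x)]; split; last first.
  by rewrite big_seq1 scale1r.
by move=> p; rewrite inE => /eqP ->.
Qed.

Lemma lin_span_submod : submod_closed (lin_span S).
Proof.
split.
  by apply/asboolP; exists [::]; split; rewrite // big_nil.
move=> a x y /asboolP[s [Hs ->]] /asboolP[t [Ht ->]]; apply/asboolP.
exists ([seq (a * p.1, p.2) | p <- s] ++ t); split.
  move=> p; rewrite mem_cat => /orP[/mapP[q qs ->] /=|/Ht //]; exact: Hs qs.
rewrite big_cat big_map /= scaler_sumr; congr (_ + _).
by apply: eq_bigr => p _; rewrite scalerA.
Qed.

HB.instance Definition _ :=
  GRing.isSubmodClosed.Build R M (lin_span S) lin_span_submod.

Lemma lin_span_ind (P : M -> Prop) :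
  P 0 -> (forall a x y, P x -> P y -> P (a *: x + y)) ->
  (forall x, S x -> P x) -> forall x, x \in lin_span S -> P x.
Proof.
move=> P0 Plin PS x /asboolP[s [Hs ->]]; elim: s Hs => [|p s IH] Hs.
  by rewrite big_nil.
rewrite big_cons; apply: Plin; first by apply/PS/Hs; rewrite inE eqxx.
by apply: IH => q qs; apply: Hs; rewrite inE qs orbT.
Qed.

End Span.

(* The quotient of M by the span of S.  It is wrapped in a record, and its
   operations are locked, to keep conversion from unfolding them. *)
Record mquot (R : nzRingType) (M : lmodType R) (S : set M) : Type :=
  MQuot { mquot_val : Quotient.quot (lin_span S) }.

HB.lock Definition mquot_pi (R : nzRingType) (M : lmodType R) (S : set M)
  (x : M) : mquot S := MQuot (\pi_(Quotient.quot (lin_span S)) x).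

HB.lock Definition mquot_repr (R : nzRingType) (M : lmodType R) (S : set M)
  (x : mquot S) : M := repr (mquot_val x).

HB.lock Definition mquot_zero (R : nzRingType) (M : lmodType R) (S : set M) :
  mquot S := mquot_pi S 0.

HB.lock Definition mquot_opp (R : nzRingType) (M : lmodType R) (S : set M)
  (x : mquot S) : mquot S := mquot_pi S (- mquot_repr x).

HB.lock Definition mquot_add (R : nzRingType) (M : lmodType R) (S : set M)
  (x y : mquot S) : mquot S := mquot_pi S (mquot_repr x + mquot_repr y).

HB.lock Definition mquot_scale (R : nzRingType) (M : lmodType R) (S : set M)
  (a : R) (x : mquot S) : mquot S := mquot_pi S (a *: mquot_repr x).

Section ModQuotient.
Variables (R : nzRingType) (M : lmodType R) (S : set M).
Local Notation I := (lin_span S).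
Local Notation pi := (mquot_pi S).
Local Notation mquot := (mquot S).

HB.instance Definition _ := [isNew for @mquot_val R M S].
HB.instance Definition _ := [Choice of mquot by <:].

Lemma mquot_reprK : cancel (@mquot_repr R M S) pi.
Proof. by case=> x; rewrite mquot_repr.unlock mquot_pi.unlock reprK. Qed.

Lemma mquot_pi_eq x y : (pi x = pi y) <-> (x - y \in I).
Proof.
rewrite mquot_pi.unlock; split=> [[e]|].
  by rewrite Quotient.idealrBE; apply/eqP.
by rewrite Quotient.idealrBE => /eqP ->.
Qed.

Lemma mquot_repr_pi x : mquot_repr (pi x) - x \in I.
Proof. by apply/mquot_pi_eq; rewrite mquot_reprK. Qed.

Let addE x y : mquot_add (pi x) (pi y) = pi (x + y).
Proof.
rewrite mquot_add.unlock; apply/mquot_pi_eq; rewrite opprD addrACA.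
by rewrite rpredD // mquot_repr_pi.
Qed.

Let oppE x : mquot_opp (pi x) = pi (- x).
Proof.
rewrite mquot_opp.unlock; apply/mquot_pi_eq; rewrite -opprD.
by rewrite rpredN mquot_repr_pi.
Qed.

Let scaleE a x : mquot_scale a (pi x) = pi (a *: x).
Proof.
rewrite mquot_scale.unlock; apply/mquot_pi_eq.
by rewrite -scalerBr rpredZ // mquot_repr_pi.
Qed.

Let zeroE : mquot_zero S = pi 0. Proof. by rewrite mquot_zero.unlock. Qed.

Let addA : associative (@mquot_add R M S).
Proof.
move=> x y z; rewrite -[x]mquot_reprK -[y]mquot_reprK -[z]mquot_reprK.
by rewrite !addE addrA.
Qed.

Let addC : commutative (@mquot_add R M S).
Proof.
by move=> x y; rewrite -[x]mquot_reprK -[y]mquot_reprK !addE addrC.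
Qed.

Let add0 : left_id (mquot_zero S) (@mquot_add R M S).
Proof. by move=> x; rewrite -[x]mquot_reprK zeroE addE add0r. Qed.

Let addN : left_inverse (mquot_zero S) (@mquot_opp R M S) (@mquot_add R M S).
Proof. by move=> x; rewrite -[x]mquot_reprK oppE addE addNr zeroE. Qed.

HB.instance Definition _ := GRing.isZmodule.Build mquot addA addC add0 addN.

Lemma mquot_piD : {morph pi : x y / x + y}.
Proof. by move=> x y; rewrite -addE. Qed.

Let scaleA a b (x : mquot) :
  mquot_scale a (mquot_scale b x) = mquot_scale (a * b) x.
Proof. by rewrite -[x]mquot_reprK !scaleE scalerA. Qed.

Let scale1 : left_id 1 (@mquot_scale R M S).
Proof. by move=> x; rewrite -[x]mquot_reprK !scaleE scale1r. Qed.

Let scaleDr : right_distributive (@mquot_scale R M S) +%R.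
Proof.
move=> a x y; rewrite -[x]mquot_reprK -[y]mquot_reprK -mquot_piD !scaleE.
by rewrite scalerDr mquot_piD.
Qed.

Let scaleDl (x : mquot) : {morph (@mquot_scale R M S)^~ x : a b / a + b}.
Proof.
by move=> a b; rewrite -[x]mquot_reprK !scaleE scalerDl mquot_piD.
Qed.

HB.instance Definition _ := GRing.Zmodule_isLmodule.Build R mquot
  scaleA scale1 scaleDr scaleDl.

Lemma mquot_piZ a : {morph pi : x / a *: x}.
Proof. by move=> x; rewrite -scaleE. Qed.

Lemma mquot_pi_is_linear : linear pi.
Proof. by move=> a x y; rewrite mquot_piD mquot_piZ. Qed.
HB.instance Definition _ :=
  GRing.isLinear.Build R M mquot *:%R pi mquot_pi_is_linear.

End ModQuotient.

Section TensorDef.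
Variables (k : fieldType) (V W : lmodType k).

Local Notation pair_basis v w := (<< (v, w) >> : {malg k[(V * W)%type]}).

Inductive tens_rel : set {malg k[(V * W)%type]} :=
| TensDl v v' w :
    tens_rel (pair_basis (v + v') w - (pair_basis v w + pair_basis v' w))
| TensDr v w w' :
    tens_rel (pair_basis v (w + w') - (pair_basis v w + pair_basis v w'))
| TensZl a v w : tens_rel (pair_basis (a *: v) w - a *: pair_basis v w)
| TensZr a v w : tens_rel (pair_basis v (a *: w) - a *: pair_basis v w).

Definition tensor : Type := mquot tens_rel.
HB.instance Definition _ := GRing.Lmodule.on tensor.

End TensorDef.

HB.lock Definition tens (k : fieldType) (V W : lmodType k) (v : V) (w : W) :
  tensor V W := mquot_pi (@tens_rel k V W) << (v, w) >>.

(* The linear map induced by f through the universal property; f is meant to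
   be bilinear, the value being junk otherwise. *)
HB.lock Definition tlift (k : fieldType) (V W X : lmodType k)
    (f : V -> W -> X) (t : tensor V W) : X :=
  let g := mquot_repr t in \sum_(p <- msupp g) g@_p *: f p.1 p.2.

Section Tensor.
Variable k : fieldType.

Section Construction.
Variables V W : lmodType k.

Local Notation pair_basis v w := (<< (v, w) >> : {malg k[(V * W)%type]}).
Local Notation tens_rel := (@tens_rel k V W).
Local Notation tens := (@tens k V W).
Local Notation tensor := (tensor V W).

Lemma tens_rel0 x y : tens_rel (x - y) ->
  mquot_pi tens_rel x = mquot_pi tens_rel y.
Proof. by move=> H; apply/mquot_pi_eq/lin_span_gen. Qed.

Lemma tens_is_bilinear : bilinear_for *:%R *:%R tens.
Proof.
split=> [w a v v' | v a w w']; rewrite tens.unlock.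
  rewrite [LHS](tens_rel0 (TensDl (a *: v) v' w)) mquot_piD.
  by rewrite (tens_rel0 (TensZl a v w)) mquot_piZ.
rewrite [LHS](tens_rel0 (TensDr v (a *: w) w')) mquot_piD.
by rewrite (tens_rel0 (TensZr a v w)) mquot_piZ.
Qed.
HB.instance Definition _ :=
  bilinear_isBilinear.Build k V W tensor *:%R *:%R tens tens_is_bilinear.

Lemma tensDl v v' w : tens (v + v') w = tens v w + tens v' w.
Proof. exact: linearDl. Qed.
Lemma tensDr v w w' : tens v (w + w') = tens v w + tens v w'.
Proof. exact: linearDr. Qed.
Lemma tensZl a v w : tens (a *: v) w = a *: tens v w.
Proof. exact: linearZl_LR. Qed.
Lemma tensZr a v w : tens v (a *: w) = a *: tens v w.
Proof. exact: linearZr_LR. Qed.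

Lemma tens_ind (P : tensor -> Prop) :
  P 0 -> (forall x y, P x -> P y -> P (x + y)) ->
  (forall v w, P (tens v w)) -> forall x, P x.
Proof.
move=> P0 PD Pt x; rewrite -[x]mquot_reprK (monalgE (mquot_repr x)) linear_sum.
elim/big_ind: _ => // -[v w] _.
have -> : << (mquot_repr x)@_(v, w) *g (v, w) >>
        = (mquot_repr x)@_(v, w) *: pair_basis v w.
  by apply/malgP => p; rewrite mcoeffZ !mcoeffU mulrnAr mulr1.
by rewrite [X in P X]mquot_piZ -[mquot_pi _ _](congr1 (fun f => f k V W v w) tens.unlock) -tensZl.
Qed.

Section Lift.
Variables (X : lmodType k) (f : {bilinear V -> W -> X}).

Let lift0 (g : {malg k[(V * W)%type]}) : X := \sum_(p <- msupp g) g@_p *: f p.1 p.2.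

Let lift0Ew (d : {fset (V * W)%type}) g : (msupp g `<=` d)%fset ->
  lift0 g = \sum_(p <- d) g@_p *: f p.1 p.2.
Proof.
move=> le; rewrite /lift0 (big_fset_incl _ le) // => p pd /mcoeff_outdom ->.
by rewrite scale0r.
Qed.

Let lift0_is_linear : linear lift0.
Proof.
move=> a g h; pose d := (msupp g `|` (msupp h `|` msupp (a *: g + h)))%fset.
have sub1 : (msupp g `<=` d)%fset by rewrite fsubsetUl.
have sub2 : (msupp h `<=` d)%fset by rewrite /d fsetUCA fsubsetUl.
have sub3 : (msupp (a *: g + h) `<=` d)%fset by rewrite /d fsetUA fsubsetUr.
rewrite (lift0Ew sub1) (lift0Ew sub2) (lift0Ew sub3).
rewrite scaler_sumr -big_split; apply: eq_bigr => p _ /=.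
by rewrite mcoeffD mcoeffZ scalerDl scalerA.
Qed.
HB.instance Definition _ :=
  GRing.isLinear.Build k {malg k[(V * W)%type]} X *:%R lift0 lift0_is_linear.

Let lift0_pair v w : lift0 (pair_basis v w) = f v w.
Proof.
rewrite (lift0Ew (d := [fset (v, w)]%fset)) ?msuppU_le // big_seq_fset1.
by rewrite mcoeffUU scale1r.
Qed.

Let lift0_rel x : x \in lin_span tens_rel -> lift0 x = 0.
Proof.
elim/lin_span_ind: x / => [|a x y|]; first exact: linear0.
  by move=> x0 y0; rewrite linearP /= x0 y0 scaler0 addr0.
move=> x [v v' w|v w w'|a v w|a v w]; rewrite linearB ?linearD ?linearZ /=
  !lift0_pair.
- by rewrite [f (v + v') w]linearDl -opprD subrr.
- by rewrite [f v (w + w')]linearDr -opprD subrr.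
- by rewrite [f (a *: v) w]linearZl_LR -scalerDr subrr scaler0.
- by rewrite [f v (a *: w)]linearZr_LR -scalerDr subrr scaler0.
Qed.

Let tlift_pi g : tlift f (mquot_pi tens_rel g) = lift0 g.
Proof.
rewrite tlift.unlock -[LHS]/(lift0 _); apply/subr0_eq; rewrite -linearB /=.
exact/lift0_rel/mquot_repr_pi.
Qed.

Lemma tliftE v w : tlift f (tens v w) = f v w.
Proof. by rewrite tens.unlock tlift_pi lift0_pair. Qed.

Lemma tlift_is_linear : linear (tlift f).
Proof.
move=> a x y; rewrite -[x]mquot_reprK -[y]mquot_reprK -linearP /=.
by rewrite !tlift_pi linearP.
Qed.
HB.instance Definition _ :=
  GRing.isLinear.Build k tensor X *:%R (tlift f) tlift_is_linear.

End Lift.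

Lemma eq_tlift (X : lmodType k) (f g : V -> W -> X) :
  f =2 g -> tlift f =1 tlift g.
Proof. by move=> e t; rewrite tlift.unlock; apply: eq_bigr => p _; rewrite e. Qed.

(* The image in tensor V W of the tensor product of two subspaces. *)
Definition tens_sub (P : set V) (Q : set W) : set tensor := fun t =>
  exists s : seq (V * W),
    (forall p, p \in s -> P p.1 /\ Q p.2) /\ t = \sum_(p <- s) tens p.1 p.2.

End Construction.

Lemma tensor_eq (V W X : lmodType k) (f g : {linear tensor V W -> X}) :
  (forall v w, f (tens v w) = g (tens v w)) -> f =1 g.
Proof.
move=> e; apply: tens_ind => [|x y ex ey|//]; first by rewrite !linear0.
by rewrite !linearD ex ey.
Qed.

Lemma tlift_bilinear (V W X : lmodType k) (f : V -> W -> X)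
    (bf : bilinear_for *:%R *:%R f) :
  linear (tlift f) /\ forall v w, tlift f (tens v w) = f v w.
Proof.
pose B := bilinear_isBilinear.Build k V W X *:%R *:%R f bf.
pose F : {bilinear V -> W -> X} := HB.pack f B.
by split=> [a x y|v w]; [exact: (tlift_is_linear F)|exact: (tliftE F)].
Qed.

Definition tmap (V V' W W' : lmodType k) (f : V -> V') (g : W -> W') :
  tensor V W -> tensor V' W' := tlift (fun v w => tens (f v) (g w)).

Definition tflip (V W : lmodType k) : tensor V W -> tensor W V :=
  tlift (fun v w => tens w v).

Definition tassoc (U V W : lmodType k) :
  tensor (tensor U V) W -> tensor U (tensor V W) :=
  tlift (fun t w => tlift (fun u v => tens u (tens v w)) t).

Section TmapTheory.
Variables (V V' W W' : lmodType k).
Variables (f : {linear V -> V'}) (g : {linear W -> W'}).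

Let tmap_bil : bilinear_for *:%R *:%R (fun v w => tens (f v) (g w)).
Proof.
split=> [w a v v'|v a w w'] /=.
  by rewrite linearP tensDl tensZl.
by rewrite linearP tensDr tensZr.
Qed.

Lemma tmapE v w : tmap f g (tens v w) = tens (f v) (g w).
Proof. exact: (tlift_bilinear tmap_bil).2. Qed.

Lemma tmap_is_linear : linear (tmap f g).
Proof. exact: (tlift_bilinear tmap_bil).1. Qed.
HB.instance Definition _ :=
  GRing.isLinear.Build k (tensor V W) (tensor V' W') *:%R (tmap f g)
    tmap_is_linear.

Lemma tmap0 : tmap f g 0 = 0. Proof. exact: linear0. Qed.
Lemma tmapD s t : tmap f g (s + t) = tmap f g s + tmap f g t.
Proof. exact: linearD. Qed.

End TmapTheory.

Lemma tflip_bil (V W : lmodType k) :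
  bilinear_for *:%R *:%R (fun (v : V) (w : W) => tens w v).
Proof.
split=> [w a v v'|v a w w'] /=; first by rewrite tensDr tensZr.
by rewrite tensDl tensZl.
Qed.

Lemma tflipE (V W : lmodType k) (v : V) (w : W) : tflip (tens v w) = tens w v.
Proof. exact: (tlift_bilinear (@tflip_bil V W)).2. Qed.

Lemma tflip_is_linear (V W : lmodType k) : linear (@tflip V W).
Proof. exact: (tlift_bilinear (@tflip_bil V W)).1. Qed.
HB.instance Definition _ (V W : lmodType k) :=
  GRing.isLinear.Build k (tensor V W) (tensor W V) *:%R (@tflip V W)
    (@tflip_is_linear V W).

Section AssocTheory.
Variables (U V W : lmodType k).

Let assoc_bil1 (w : W) :
  bilinear_for *:%R *:%R (fun (u : U) (v : V) => tens u (tens v w)).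
Proof.
split=> [v a u u'|u a v v'] /=; first by rewrite tensDl tensZl.
by rewrite tensDl tensDr tensZl tensZr.
Qed.

Let assoc_bil : bilinear_for *:%R *:%R
  (fun t (w : W) => tlift (fun (u : U) (v : V) => tens u (tens v w)) t).
Proof.
split=> [w a t t'|t a w w'] /=; first exact: (tlift_bilinear (assoc_bil1 w)).1.
elim/tens_ind: t => [|x y Hx Hy|u v].
- have l0 (z : W) : tlift (fun (u : U) (v : V) => tens u (tens v z)) 0 = 0.
    have /(_ (-1) 0 0) := (tlift_bilinear (assoc_bil1 z)).1.
    by rewrite scaler0 addr0 scaleN1r addNr.
  by rewrite (l0 w) (l0 w') (l0 (a *: w + w')) scaler0 addr0.
- have lD (z : W) : {morph tlift (fun (u : U) (v : V) => tens u (tens v z)) :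
               s t / s + t}.
    move=> s t; have /(_ 1 s t) := (tlift_bilinear (assoc_bil1 z)).1.
    by rewrite !scale1r.
  by rewrite (lD w) (lD w') (lD (a *: w + w')) Hx Hy scalerDr addrACA.
- have E (z : W) := (tlift_bilinear (assoc_bil1 z)).2.
  by rewrite (E w) (E w') (E (a *: w + w')) !tensDr !tensZr.
Qed.

Lemma tassocE (u : U) (v : V) (w : W) :
  tassoc (tens (tens u v) w) = tens u (tens v w).
Proof.
rewrite /tassoc (tlift_bilinear assoc_bil).2.
exact: (tlift_bilinear (assoc_bil1 w)).2.
Qed.

Lemma tassoc_is_linear : linear (@tassoc U V W).
Proof. exact: (tlift_bilinear assoc_bil).1. Qed.
HB.instance Definition _ :=
  GRing.isLinear.Build k (tensor (tensor U V) W) (tensor U (tensor V W)) *:%R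
    (@tassoc U V W) tassoc_is_linear.

End AssocTheory.

(* The algebra structure (a \ox b) * (a' \ox b') = (a * a') \ox (b * b'). *)
Section TensorAlgebra.
Variables A B : algType k.

Definition tens_mul (s t : tensor A B) : tensor A B :=
  tlift (fun a b => tmap (a \*o idfun) (b \*o idfun) t) s.

Definition tens_one : tensor A B := tens 1 1.

Let mul_bil t : bilinear_for *:%R *:%R
  (fun (a : A) (b : B) => tmap (a \*o idfun) (b \*o idfun) t).
Proof.
elim/tens_ind: t => [|s t [s1 s2] [t1 t2]|x y].
- by split=> [? ? ? ?|? ? ? ?] /=; rewrite !tmap0 scaler0 addr0.
- split=> [b a x y|x a y b] /=; rewrite !tmapD.
    by rewrite [LHS](f_equal2 +%R (s1 b a x y) (t1 b a x y)) scalerDr addrACA.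
  by rewrite [LHS](f_equal2 +%R (s2 x a y b) (t2 x a y b)) scalerDr addrACA.
- split=> [b c a a'|a c b b'] /=; rewrite !tmapE /=.
    by rewrite mulrDl -scalerAl tensDl tensZl.
  by rewrite mulrDl -scalerAl tensDr tensZr.
Qed.

Lemma tens_mul_linl t : linear (tens_mul^~ t).
Proof. exact: (tlift_bilinear (mul_bil t)).1. Qed.

Lemma tens_mul_pure a b t :
  tens_mul (tens a b) t = tmap (a \*o idfun) (b \*o idfun) t.
Proof. exact: (tlift_bilinear (mul_bil t)).2. Qed.

Lemma tens_mulE a b a' b' :
  tens_mul (tens a b) (tens a' b') = tens (a * a') (b * b').
Proof. by rewrite tens_mul_pure tmapE. Qed.

Lemma tens_mulDl : left_distributive tens_mul +%R.
Proof.
by move=> x y z; have := tens_mul_linl z 1 x y; rewrite !scale1r.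
Qed.

Lemma tens_mulZl c s t : tens_mul (c *: s) t = c *: tens_mul s t.
Proof. exact: (scalable_linear (tens_mul_linl t)). Qed.

Lemma tens_mul0l t : tens_mul 0 t = 0.
Proof.
by have := tens_mulZl 0 0 t; rewrite !scale0r.
Qed.

Lemma tens_mul_linr s : linear (tens_mul s).
Proof.
elim/tens_ind: s => [|x y Hx Hy|a b] c t u.
- by rewrite !tens_mul0l scaler0 addr0.
- by rewrite !tens_mulDl Hx Hy scalerDr addrACA.
- by rewrite !tens_mul_pure linearP.
Qed.
HB.instance Definition _ s :=
  GRing.isLinear.Build k (tensor A B) (tensor A B) *:%R (tens_mul s)
    (tens_mul_linr s).

Lemma tens_mul0r s : tens_mul s 0 = 0. Proof. exact: linear0. Qed.

Lemma tens_mulDr : right_distributive tens_mul +%R.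
Proof. by move=> s t u; rewrite linearD. Qed.

Lemma tens_mulA : associative tens_mul.
Proof.
move=> s t u.
elim/tens_ind: s => [|x y Hx Hy|a b].
- by rewrite !tens_mul0l.
- by rewrite !tens_mulDl Hx Hy.
elim/tens_ind: t => [|x y Hx Hy|a' b'].
- by rewrite tens_mul0l !tens_mul0r tens_mul0l.
- by rewrite tens_mulDl !tens_mulDr tens_mulDl Hx Hy.
elim/tens_ind: u => [|x y Hx Hy|a'' b'']; first by rewrite !tens_mul0r.
  by rewrite !tens_mulDr Hx Hy.
by rewrite !tens_mulE !mulrA.
Qed.

Lemma tens_mul1l : left_id tens_one tens_mul.
Proof.
elim/tens_ind=> [|x y Hx Hy|a b]; first by rewrite tens_mul0r.
  by rewrite tens_mulDr Hx Hy.
by rewrite tens_mulE !mul1r.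
Qed.

Lemma tens_mul1r : right_id tens_one tens_mul.
Proof.
elim/tens_ind=> [|x y Hx Hy|a b]; first by rewrite tens_mul0l.
  by rewrite tens_mulDl Hx Hy.
by rewrite tens_mulE !mulr1.
Qed.

HB.instance Definition _ := GRing.Zmodule_isPzRing.Build (tensor A B)
  tens_mulA tens_mul1l tens_mul1r tens_mulDl tens_mulDr.

Lemma tens_oneE : (1 : tensor A B) = tens 1 1. Proof. by []. Qed.

Lemma tensM a b a' b' :
  (tens a b * tens a' b' : tensor A B) = tens (a * a') (b * b').
Proof. exact: tens_mulE. Qed.

Lemma tens_scalerAl c (s t : tensor A B) : c *: (s * t) = (c *: s) * t.
Proof. by rewrite [RHS]tens_mulZl. Qed.

Lemma tens_scalerAr c (s t : tensor A B) : c *: (s * t) = s * (c *: t).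
Proof. by symmetry; apply: (linearZ_LR (tens_mul s)). Qed.

End TensorAlgebra.
End Tensor.

Arguments tflip {k V W} t.
Arguments tassoc {k U V W} t.

Notation "v \ox w" := (tens v w) (at level 38, left associativity) : ring_scope.

HB.mixin Record Algebra_isHopf (k : fieldType) H of GRing.Algebra k H := {
  comul : {linear H -> tensor H H};
  counit : {scalar H};
  antipode : {linear H -> H};
  comul_monoid_morphism : monoid_morphism comul;
  counit_monoid_morphism : monoid_morphism counit;
  comulA : forall h,
    tassoc (tmap comul idfun (comul h)) = tmap idfun comul (comul h);
  counitl : forall h, tlift (fun x y => counit x *: y) (comul h) = h;
  counitr : forall h, tlift (fun x y => counit y *: x) (comul h) = h;
  antipodel : forall h,
    tlift (fun x y => antipode x * y) (comul h) = (counit h)%:A;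
  antipoder : forall h,
    tlift (fun x y => x * antipode y) (comul h) = (counit h)%:A
}.

#[short(type="hopfAlgType")]
HB.structure Definition HopfAlgebra (k : fieldType) :=
  {H of GRing.Algebra k H & Algebra_isHopf k H}.

Section HopfPredicates.
Variables (k : fieldType) (H : hopfAlgType k).

Definition group_like (g : H) : Prop := comul g = g \ox g /\ counit g = 1.

Definition cocommutative : Prop :=
  forall h : H, tflip (comul h) = comul h.

Definition involutory : Prop := forall h : H, antipode (antipode h) = h.

Definition antipode_finite_order : Prop :=
  exists2 m : nat, (0 < m)%N & forall h : H, iter m antipode h = h.

Definition central (z : H) : Prop := forall h : H, z * h = h * z.

Definition hopf_subalgebra (B : set H) : Prop :=
  [/\ B 1,
      forall (a : k) x y, B x -> B y -> B (a *: x + y),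
      forall x y, B x -> B y -> B (x * y),
      forall x, B x -> tens_sub B B (comul x)
    & forall x, B x -> B (antipode x)].

Definition comodule_algebra (A : algType k) (rho : {linear A -> tensor A H}) :
  Prop :=
  [/\ forall a, tassoc (tmap rho idfun (rho a)) = tmap idfun comul (rho a),
      forall a, tlift (fun x h => counit h *: x) (rho a) = a
    & monoid_morphism rho].

Definition inner_faithful (A : algType k) (rho : {linear A -> tensor A H}) :
  Prop :=
  forall B : set H, hopf_subalgebra B -> B `<` setT ->
    ~ (range rho `<=` tens_sub setT B).

Definition preserves_grading (A : algType k) (deg : nat -> set A)
    (rho : {linear A -> tensor A H}) : Prop :=
  forall d a, deg d a -> tens_sub (deg d) setT (rho a).

End HopfPredicates.

Definition hopf_iso (k : fieldType) (H K : hopfAlgType k)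
    (f : {linear H -> K}) : Prop :=
  [/\ bijective f, monoid_morphism f,
      forall h, comul (f h) = tmap f f (comul h)
    & forall h, counit (f h) = counit h].

Definition finite_dimensional (k : fieldType) (V : lmodType k) : Prop :=
  exists n (b : 'I_n -> V), forall v, exists c : 'I_n -> k,
    v = \sum_i c i *: b i.

Definition group_alg (k : fieldType) (gT : finGroupType) : Type :=
  {ffun gT -> k^o}.

Section GroupAlgebra.
Variables (k : fieldType) (gT : finGroupType).
Local Notation kG := (group_alg k gT).

HB.instance Definition _ := GRing.Lmodule.copy kG {ffun gT -> k^o}.

Definition gbasis (g : gT) : kG := [ffun x => (x == g)%:R].

Definition galg_mul (f h : kG) : kG :=
  [ffun x => \sum_y f y * h (y^-1 * x)%g].

Let gcoefD (f h : kG) x : (f + h) x = f x + h x. Proof. by rewrite ffunE. Qed.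
Let gcoefZ a (f : kG) x : (a *: f) x = a * f x. Proof. by rewrite ffunE. Qed.

Lemma galg_mulA : associative galg_mul.
Proof.
move=> f g h; apply/ffunP=> x; rewrite !ffunE.
under eq_bigr => y _ do rewrite ffunE mulr_sumr.
under [RHS]eq_bigr => y _ do rewrite ffunE mulr_suml.
rewrite [RHS]exchange_big; apply: eq_bigr => y _ /=.
rewrite [RHS](reindex_inj (mulgI y)); apply: eq_bigr => z _.
by rewrite mulKg invMg !mulgA mulrA.
Qed.

Lemma galg_mul1l : left_id (gbasis 1%g) galg_mul.
Proof.
move=> f; apply/ffunP=> x; rewrite ffunE (bigD1 1%g) //= big1 => [|y ny].
  by rewrite ffunE eqxx mul1r invg1 mul1g addr0.
by rewrite ffunE (negbTE ny) mul0r.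
Qed.

Lemma galg_mul1r : right_id (gbasis 1%g) galg_mul.
Proof.
move=> f; apply/ffunP=> x; rewrite ffunE (bigD1 x) //= big1 => [|y ny].
  by rewrite ffunE mulVg eqxx mulr1 addr0.
by rewrite ffunE -eq_mulVg1 (negbTE ny) mulr0.
Qed.

Lemma galg_mulDl : left_distributive galg_mul +%R.
Proof.
move=> f g h; apply/ffunP=> x; rewrite gcoefD !ffunE -big_split /=.
by apply: eq_bigr => y _; rewrite gcoefD mulrDl.
Qed.

Lemma galg_mulDr : right_distributive galg_mul +%R.
Proof.
move=> f g h; apply/ffunP=> x; rewrite gcoefD !ffunE -big_split /=.
by apply: eq_bigr => y _; rewrite gcoefD mulrDr.
Qed.

Lemma galg_1_neq0 : gbasis 1%g != 0.
Proof.
by apply/eqP => /ffunP/(_ 1%g)/eqP; rewrite !ffunE eqxx oner_eq0.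
Qed.

HB.instance Definition _ := GRing.Zmodule_isNzRing.Build kG
  galg_mulA galg_mul1l galg_mul1r galg_mulDl galg_mulDr galg_1_neq0.

Lemma galg_scalerAl (a : k) (f h : kG) : a *: (f * h) = (a *: f) * h.
Proof.
apply/ffunP=> x; rewrite gcoefZ !ffunE mulr_sumr.
by apply: eq_bigr => y _; rewrite gcoefZ mulrA.
Qed.
HB.instance Definition _ :=
  GRing.Lmodule_isLalgebra.Build k kG galg_scalerAl.

Lemma galg_scalerAr (a : k) (f h : kG) : a *: (f * h) = f * (a *: h).
Proof.
apply/ffunP=> x; rewrite gcoefZ !ffunE mulr_sumr.
by apply: eq_bigr => y _; rewrite gcoefZ mulrCA.
Qed.
HB.instance Definition _ := GRing.Lalgebra_isAlgebra.Build k kG galg_scalerAr.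

Lemma gbasis1 : gbasis 1%g = 1. Proof. by []. Qed.

Lemma gbasisM g h : gbasis g * gbasis h = gbasis (g * h)%g.
Proof.
apply/ffunP=> x; rewrite !ffunE (bigD1 g) //= big1 => [|y ny].
  by rewrite !ffunE eqxx mul1r addr0 -(inj_eq (mulgI g)) mulKVg.
by rewrite ffunE (negbTE ny) mul0r.
Qed.

Lemma galgE (f : kG) : f = \sum_g f g *: gbasis g.
Proof.
apply/ffunP=> x; rewrite sum_ffunE (bigD1 x) //= big1 => [|y ny].
  by rewrite gcoefZ ffunE eqxx mulr1 addr0.
by rewrite gcoefZ ffunE eq_sym (negbTE ny) mulr0.
Qed.

Lemma galg_ind (P : kG -> Prop) :
  P 0 -> (forall a x y, P x -> P y -> P (a *: x + y)) ->
  (forall g, P (gbasis g)) -> forall f, P f.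
Proof.
move=> P0 Plin Pg f; rewrite [f]galgE; elim/big_ind: _ => // [x y Px Py|g _].
  by rewrite -[x]scale1r; apply: Plin.
by rewrite -[_ *: _]addr0; apply: Plin.
Qed.

Definition galg_comul (f : kG) : tensor kG kG :=
  \sum_g f g *: (gbasis g \ox gbasis g).
Definition galg_counit (f : kG) : k := \sum_g f g.
Definition galg_antipode (f : kG) : kG := \sum_g f g *: gbasis g^-1%g.

Lemma galg_comul_linear : linear galg_comul.
Proof.
move=> a f h; rewrite /galg_comul scaler_sumr -big_split /=.
by apply: eq_bigr => g _; rewrite gcoefD gcoefZ scalerDl scalerA.
Qed.
HB.instance Definition _ :=
  GRing.isLinear.Build k kG (tensor kG kG) *:%R galg_comul galg_comul_linear.

Lemma galg_counit_scalar : scalar galg_counit.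
Proof.
move=> a f h; rewrite /galg_counit mulr_sumr -big_split /=.
by apply: eq_bigr => g _; rewrite gcoefD gcoefZ.
Qed.
HB.instance Definition _ :=
  GRing.isLinear.Build k kG k *%R galg_counit galg_counit_scalar.

Lemma galg_antipode_linear : linear galg_antipode.
Proof.
move=> a f h; rewrite /galg_antipode scaler_sumr -big_split /=.
by apply: eq_bigr => g _; rewrite gcoefD gcoefZ scalerDl scalerA.
Qed.
HB.instance Definition _ :=
  GRing.isLinear.Build k kG kG *:%R galg_antipode galg_antipode_linear.

Lemma galg_comulE g : galg_comul (gbasis g) = gbasis g \ox gbasis g.
Proof.
rewrite /galg_comul (bigD1 g) //= big1 => [|y ny].
  by rewrite ffunE eqxx scale1r addr0.
by rewrite ffunE (negbTE ny) scale0r.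
Qed.

Lemma galg_counitE g : galg_counit (gbasis g) = 1.
Proof.
rewrite /galg_counit (bigD1 g) //= big1 => [|y ny].
  by rewrite ffunE eqxx addr0.
by rewrite ffunE (negbTE ny).
Qed.

Lemma galg_antipodeE g : galg_antipode (gbasis g) = gbasis g^-1%g.
Proof.
rewrite /galg_antipode (bigD1 g) //= big1 => [|y ny].
  by rewrite ffunE eqxx scale1r addr0.
by rewrite ffunE (negbTE ny) scale0r.
Qed.

Lemma galg_eq_linear (X : lmodType k) (f h : {linear kG -> X}) :
  (forall g, f (gbasis g) = h (gbasis g)) -> f =1 h.
Proof.
move=> e; elim/galg_ind => [|a x y ex ey|//]; first by rewrite !linear0.
by rewrite !linearP ex ey.
Qed.

Lemma galg_comul_mm : monoid_morphism galg_comul.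
Proof.
split; first by rewrite -gbasis1 galg_comulE.
elim/galg_ind => [|a x y Hx Hy|g] h; first by rewrite !(mul0r, linear0).
  by rewrite mulrDl -scalerAl !linearP /= Hx Hy mulrDl -tens_scalerAl.
elim/galg_ind: h => [|a x y Hx Hy|h]; first by rewrite !(mulr0, linear0).
  by rewrite mulrDr -scalerAr !linearP /= Hx Hy mulrDr -tens_scalerAr.
by rewrite gbasisM !galg_comulE tensM gbasisM.
Qed.

Lemma galg_counit_mm : monoid_morphism galg_counit.
Proof.
split; first by rewrite -gbasis1 galg_counitE.
elim/galg_ind => [|a x y Hx Hy|g] h; first by rewrite !(mul0r, linear0).
  by rewrite mulrDl -scalerAl !linearP /= Hx Hy mulrDl mulrA.
elim/galg_ind: h => [|a x y Hx Hy|h]; first by rewrite !(mulr0, linear0).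
  by rewrite mulrDr -scalerAr !linearP /= Hx Hy mulrDr mulrCA.
by rewrite gbasisM !galg_counitE mulr1.
Qed.

Lemma galg_comulA (f : kG) :
  tassoc (tmap galg_comul idfun (galg_comul f)) =
  tmap idfun galg_comul (galg_comul f).
Proof.
elim/galg_ind: f => [|a x y Hx Hy|g]; first by rewrite !linear0.
  by rewrite !linearP /= Hx Hy.
by rewrite galg_comulE !tmapE /= galg_comulE tassocE.
Qed.

Let lift_ext (F : kG -> kG -> kG) (f : kG) (L : {linear kG -> kG}) :
  bilinear_for *:%R *:%R F -> (forall g, F (gbasis g) (gbasis g) = L (gbasis g)) ->
  tlift F (galg_comul f) = L f.
Proof.
move=> bF e; have [lF EF] := tlift_bilinear bF.
elim/galg_ind: f => [|a x y Hx Hy|g]; last by rewrite galg_comulE EF e.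
  by rewrite !linear0; have := scalable_linear lF 0 0; rewrite /= !scale0r.
by rewrite !linearP /= lF Hx Hy.
Qed.

Lemma galg_counitl (f : kG) :
  tlift (fun x y => galg_counit x *: y) (galg_comul f) = f.
Proof.
apply: (lift_ext _ (L := idfun)) => [|g]; last by rewrite galg_counitE scale1r.
split=> [u a x y|u a x y] /=; first by rewrite linearP /= scalerDl scalerA.
by rewrite scalerDr !scalerA mulrC.
Qed.

Lemma galg_counitr (f : kG) :
  tlift (fun x y => galg_counit y *: x) (galg_comul f) = f.
Proof.
apply: (lift_ext _ (L := idfun)) => [|g]; last by rewrite galg_counitE scale1r.
split=> [u a x y|u a x y] /=; last by rewrite linearP /= scalerDl scalerA.
by rewrite scalerDr !scalerA mulrC.
Qed.

Definition galg_unit_counit (f : kG) : kG := (galg_counit f)%:A.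
Lemma galg_unit_counit_linear : linear galg_unit_counit.
Proof.
by move=> a f h; rewrite /galg_unit_counit linearP /= scalerDl scalerA.
Qed.
HB.instance Definition _ :=
  GRing.isLinear.Build k kG kG *:%R galg_unit_counit galg_unit_counit_linear.

Lemma galg_antipodel (f : kG) :
  tlift (fun x y => galg_antipode x * y) (galg_comul f) = (galg_counit f)%:A.
Proof.
apply: (lift_ext _ (L := galg_unit_counit)) => [|g].
  split=> [u a x y|u a x y] /=; first by rewrite linearP /= mulrDl scalerAl.
  by rewrite mulrDr scalerAr.
by rewrite galg_antipodeE gbasisM mulVg /= /galg_unit_counit galg_counitE scale1r.
Qed.

Lemma galg_antipoder (f : kG) :
  tlift (fun x y => x * galg_antipode y) (galg_comul f) = (galg_counit f)%:A.
Proof.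
apply: (lift_ext _ (L := galg_unit_counit)) => [|g].
  split=> [u a x y|u a x y] /=; first by rewrite mulrDl scalerAl.
  by rewrite linearP /= mulrDr scalerAr.
by rewrite galg_antipodeE gbasisM mulgV /= /galg_unit_counit galg_counitE scale1r.
Qed.

HB.instance Definition _ := Algebra_isHopf.Build k kG
  galg_comul_mm galg_counit_mm galg_comulA galg_counitl galg_counitr
  galg_antipodel galg_antipoder.

End GroupAlgebra.

Definition is_group_algebra (k : fieldType) (H : hopfAlgType k) : Prop :=
  exists (gT : finGroupType) (f : {linear H -> group_alg k gT}), hopf_iso f.

Definition free_alg (k : fieldType) (N : nat) : Type := {malg k[{fmonom 'I_N}]}.

Lemma malg_scalerAr (k : fieldType) (K : monomType) (a : k)
  (x y : {malg k[K]}) : a *: (x * y) = x * (a *: y).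
Proof.
rewrite [x * y]malgME [x * (a *: y)](malgMEw (fsubset_refl _) (msuppZ_le _ _)).
rewrite scaler_sumr; apply: eq_bigr => m _.
rewrite scaler_sumr; apply: eq_bigr => m' _.
apply/malgP => p; rewrite mcoeffZ mcoeffZ !mcoeffU.
by rewrite mulrnAr mulrCA.
Qed.

Section FreeAlgebra.
Variables (k : fieldType) (N : nat).
Local Notation F := (free_alg k N).

HB.instance Definition _ := GRing.Lalgebra.copy F {malg k[{fmonom 'I_N}]}.

HB.instance Definition _ :=
  GRing.Lalgebra_isAlgebra.Build k F (@malg_scalerAr k {fmonom 'I_N}).

Definition fvar (i : 'I_N) : F := << fmu i >>.

(* The span of the words of length d. *)
Definition free_deg (d : nat) : set F :=
  [set x : F | forall m, m \in msupp (x : {malg k[{fmonom 'I_N}]}) -> fdeg m = d].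

Variable E : 'M[k]_N.

Definition quad_rel : F := \sum_(i < N) \sum_(j < N) E i j *: (fvar i * fvar j).

(* Its linear span is the two-sided ideal generated by quad_rel. *)
Definition quad_ideal_gen : set F :=
  [set z : F | exists x y : F, z = x * quad_rel * y].

Definition AE : Type := mquot quad_ideal_gen.
HB.instance Definition _ := GRing.Lmodule.on AE.

Definition AE_pi (x : F) : AE := mquot_pi quad_ideal_gen x.
HB.instance Definition _ :=
  GRing.isLinear.Build k F AE *:%R AE_pi (@mquot_pi_is_linear _ _ quad_ideal_gen).

Local Notation I := (lin_span quad_ideal_gen).

Let idealMl x y : y \in I -> x * y \in I.
Proof.
elim/lin_span_ind: y / => [|a u v Iu Iv|y [u [v ->]]].
- by rewrite mulr0 rpred0.
- by rewrite mulrDr -scalerAr rpredD // rpredZ.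
- by apply: lin_span_gen; exists (x * u), v; rewrite !mulrA.
Qed.

Let idealMr x y : x \in I -> x * y \in I.
Proof.
elim/lin_span_ind: x / => [|a u v Iu Iv|x [u [v ->]]].
- by rewrite mul0r rpred0.
- by rewrite mulrDl -scalerAl rpredD // rpredZ.
- by apply: lin_span_gen; exists u, (v * y); rewrite !mulrA.
Qed.

Definition AE_mul (x y : AE) : AE := AE_pi (mquot_repr x * mquot_repr y).

Lemma AE_piM x y : AE_pi (x * y) = AE_mul (AE_pi x) (AE_pi y).
Proof.
apply/mquot_pi_eq.
set x' := mquot_repr _; set y' := mquot_repr _.
have -> : x * y - x' * y' = - ((x' - x) * y' + x * (y' - y)).
  by rewrite mulrBl mulrBr addrA subrK opprB.
rewrite rpredN rpredD //; first exact/idealMr/mquot_repr_pi.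
exact/idealMl/mquot_repr_pi.
Qed.

Lemma AE_reprK : cancel (fun x : AE => mquot_repr x) AE_pi.
Proof. exact: mquot_reprK. Qed.

Lemma AE_mulA : associative AE_mul.
Proof.
move=> x y z; rewrite -[x]AE_reprK -[y]AE_reprK -[z]AE_reprK.
by rewrite -!AE_piM mulrA.
Qed.

Lemma AE_mul1l : left_id (AE_pi 1) AE_mul.
Proof. by move=> x; rewrite -[x]AE_reprK -AE_piM mul1r. Qed.

Lemma AE_mul1r : right_id (AE_pi 1) AE_mul.
Proof. by move=> x; rewrite -[x]AE_reprK -AE_piM mulr1. Qed.

Lemma AE_mulDl : left_distributive AE_mul +%R.
Proof.
move=> x y z; rewrite -[x]AE_reprK -[y]AE_reprK -[z]AE_reprK.
by rewrite -linearD -!AE_piM mulrDl linearD.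
Qed.

Lemma AE_mulDr : right_distributive AE_mul +%R.
Proof.
move=> x y z; rewrite -[x]AE_reprK -[y]AE_reprK -[z]AE_reprK.
by rewrite -linearD -!AE_piM mulrDr linearD.
Qed.

Let eps (x : F) : k := (x : {malg k[{fmonom 'I_N}]})@_(@mone {fmonom 'I_N}).

Let epsM x y : eps (x * y) = eps x * eps y.
Proof.
by have [M _] := mcoeff1g_is_multiplicative {fmonom 'I_N} k; apply: M.
Qed.

Let epsP a x y : eps (a *: x + y) = a * eps x + eps y.
Proof. by rewrite /eps [LHS]mcoeffD mcoeffZ. Qed.

Let eps_var i : eps (fvar i) = 0.
Proof.
rewrite /eps /fvar mcoeffU; case: eqP => // e.
by have := fdegU i; rewrite e fdeg1.
Qed.

Lemma AE_1_neq0 : AE_pi 1 != 0.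
Proof.
apply/eqP; rewrite -[RHS](linear0 AE_pi) => /mquot_pi_eq; rewrite subr0 => I1.
have eps0 : eps 0 = 0 by rewrite /eps [LHS]mcoeff0.
have epsS (J : Type) (r : seq J) (G : J -> F) :
    (forall j, eps (G j) = 0) -> eps (\sum_(j <- r) G j) = 0.
  move=> G0; elim/big_ind: _ => [//|x y x0 y0|j _]; last exact: G0.
  by rewrite -[x]scale1r epsP x0 y0 mulr0 addr0.
have epsr : eps quad_rel = 0.
  apply: (epsS) => i; apply: (epsS) => j.
  by rewrite -[_ *: _]addr0 epsP epsM eps_var mul0r mulr0 eps0 addr0.
have /(_ 1 I1) : forall z, z \in I -> eps z = 0.
  move=> z; elim/lin_span_ind: z / => [//|a x y x0 y0|x [u [v ->]]].
    by rewrite epsP x0 y0 mulr0 addr0.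
  by rewrite !epsM epsr mulr0 mul0r.
have [_ e] := mcoeff1g_is_multiplicative {fmonom 'I_N} k.
by rewrite (e : eps 1 = 1) => /eqP; rewrite oner_eq0.
Qed.

HB.instance Definition _ := GRing.Zmodule_isNzRing.Build AE
  AE_mulA AE_mul1l AE_mul1r AE_mulDl AE_mulDr AE_1_neq0.

Lemma AE_scalerAl (a : k) (x y : AE) : a *: (x * y) = (a *: x) * y.
Proof.
rewrite -[x]AE_reprK -[y]AE_reprK -[a *: AE_pi _]linearZ.
by rewrite -[_ * _]AE_piM -[RHS]AE_piM -linearZ scalerAl.
Qed.
HB.instance Definition _ := GRing.Lmodule_isLalgebra.Build k AE AE_scalerAl.

Lemma AE_scalerAr (a : k) (x y : AE) : a *: (x * y) = x * (a *: y).
Proof.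
rewrite -[x]AE_reprK -[y]AE_reprK -[a *: AE_pi _]linearZ.
by rewrite -[_ * _]AE_piM -[RHS]AE_piM -linearZ scalerAr.
Qed.
HB.instance Definition _ := GRing.Lalgebra_isAlgebra.Build k AE AE_scalerAr.

Lemma AE_pi_monoid_morphism : monoid_morphism AE_pi.
Proof. by split=> // x y; rewrite AE_piM. Qed.
HB.instance Definition _ :=
  GRing.isMonoidMorphism.Build F AE AE_pi AE_pi_monoid_morphism.

Definition AE_deg (d : nat) : set AE := AE_pi @` free_deg d.

(* The graded coaction rhoF on the free algebra inducing rho is unique, since
   AE_pi is injective in degree 1. *)
Definition homological_codeterminant (H : hopfAlgType k)
    (rho : {linear AE -> tensor AE H}) (D : H) : Prop :=
  exists rhoF : {linear F -> tensor F H},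
    [/\ comodule_algebra rhoF,
        preserves_grading free_deg rhoF,
        forall x, rho (AE_pi x) = tmap AE_pi idfun (rhoF x),
        group_like D
      & exists Dinv : H,
          [/\ D * Dinv = 1, Dinv * D = 1
            & rhoF quad_rel = quad_rel \ox Dinv]].

End FreeAlgebra.

Arguments AE_deg {k N} E d.

Section CanonicalForms.
Variable k : fieldType.

Definition congruent N (E E' : 'M[k]_N) : Prop :=
  exists2 P : 'M[k]_N, P \in unitmx & E' = P^T *m E *m P.

(* Indices start from 0: the antidiagonal (i, n+1-i) becomes i + j + 1 = n, and
   the line (i, n+2-i) becomes i + j = n. *)
Definition J_mx n : 'M[k]_n :=
  \matrix_(i, j) if [|| (i + j).+1 == n | i + j == n]%N
                 then (-1) ^+ (n - i.+1) else 0.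

Definition B_mx r (q : k) : 'M[k]_r :=
  \matrix_(i, j) if i == j then q else if j == i.+1 :> nat then 1 else 0.

Definition D_mx r (q : k) : 'M[k]_(r + r) :=
  block_mx 0 1%:M (B_mx r q) 0.

Definition Dsum_mx s (r : 'I_s -> nat) (q : 'I_s -> k) :
  'M[k]_(\sum_(i < s) (r i + r i)) := \mxdiag_(i < s) D_mx (r i) (q i).

Definition JDsum_mx n s (r : 'I_s -> nat) (q : 'I_s -> k) :
  'M[k]_(n + \sum_(i < s) (r i + r i)) :=
  block_mx (J_mx n) 0 0 (Dsum_mx r q).

Definition distinct_with_inverses s (x : 'I_s -> k) : bool :=
  uniq (flatten [seq [:: x i; (x i)^-1] | i <- enum 'I_s]).

End CanonicalForms.

(* Main.v *)
Require Import Defs.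
From HB Require Import structures.
From mathcomp Require Import all_boot all_order all_fingroup all_algebra.
From mathcomp Require Import separable zify ring finmap monalg.
From mathcomp Require Import boolp classical_sets.

Set Implicit Arguments.
Unset Strict Implicit.
Unset Printing Implicit Defensive.

Import GRing.Theory.
Local Open Scope ring_scope.

(** Write the coaction on the generators as [v_j |-> \sum_i v_i (x) y_ij] and
    let [Y] be the matrix of the [y_ij] over [H].  Coassociativity makes [Y] a
    comatrix: [Delta y_ij = \sum_l y_il (x) y_lj], so that [S(Y)] is the inverse
    of [Y].  Comparing the coefficients of [v_a v_b] in [rho r = r (x) D^-1]
    gives [Y E Y^T = E D^-1], hence [S(Y) = E Y^T E^-1 D] and
    [S^2(Y) = D^-1 (M Y M^-1) D], where [M = E E^-T] is the cosquare of [E].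
    Iterating, either hypothesis yields an exponent [j >= 1] for which
    [S^(2j) = id] and [D^j] is central ([common_exponent]), and then [Y] commutes
    with [M^j], a matrix over the base field ([coeff_cosquare_comm]).

    The matrix [M^j] has eigenspaces of dimension at most one
    ([nonderogatory_cosquareX]).  An eigenvector of [M] is a row [v] with
    [v E = mu v E^T], a condition which is compatible with congruence and with
    block sums, and which is solved by hand on the blocks [J_n] and [D_2r(q)]:
    the eigenvalues are a sign for [J_n], and [q] and [q^-1] for [D_2r(q)], with
    one eigenline each.  The distinctness hypothesis says that these eigenvalues
    have distinct [j]-th powers.  As [X^j - mu] splits into distinct linear
    factors, at most one of which is singular at [M], the same holds for [M^j].

    Let now [v] be a generalized eigenvector of [M^j] for an eigenvalue [z], and
    let [A = M^j - z].  The rows [v A^t] span the kernel of a power of [A], so [Y]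
    preserves their span and acts on it by an upper triangular Toeplitz matrix
    [(y_(t-b))_(b,t)].  Being a comatrix, it satisfies
    [Delta y_t = \sum_(l <= t) y_l (x) y_(t-l)] ([commuting_row]).  Since the
    generalized eigenvectors span, every [y_ij] is a linear combination of such
    [y_t] ([coeff_in_submodule]).  These are visibly cocommutative, and inner
    faithfulness propagates properties of the [y_ij] to all of [H]
    ([inner_faithful_ind]): [H] is cocommutative.

    If [H] is finite dimensional, then [y_0] is group-like, and inductively
    [y_0^-1 y_t] is primitive for [t > 0], hence zero because the characteristic
    is zero ([primitive_eq0]).  So the [y_ij], and therefore all elements of [H],
    are combinations of group-like elements.  These are linearly independent, and
    [H] is their group algebra ([group_like_span_group_algebra]). *)

(** * Eigenvectors of a cosquare *)

Section PencilSpectrum.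
Variable k : fieldType.

(** [lam] lists the possible [mu] for which [v E = mu v E^T] has a nonzero solution
    [v]; a solution for [mu] is pinned down by its values under the functionals
    [c b] with [lam b = mu].  For invertible [E] these [v] are the eigenvectors of
    the cosquare [E E^-T], but the condition on [E] is bilinear, which is what
    makes it easy to transport along congruences and block sums.  When [lam] is
    injective it gives eigenspaces of dimension at most one. *)
Definition pencil_spectrum (T : finType) N (E : 'M[k]_N) (lam : T -> k)
    (c : T -> 'cV[k]_N) : Prop :=
  forall (mu : k) (v : 'rV[k]_N), v *m E = mu *: (v *m E^T) ->
    (forall b, lam b = mu -> v *m c b = 0) -> v = 0.

Lemma congruent_spectrum (T : finType) N (E E' : 'M[k]_N) (lam : T -> k)
    (c' : T -> 'cV[k]_N) :
  congruent E E' -> pencil_spectrum E' lam c' ->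
  exists c : T -> 'cV[k]_N, pencil_spectrum E lam c.
Proof.
move=> [P Pu ->] sp; have Ptu : P^T \in unitmx by rewrite unitmx_tr.
exists (fun b => invmx P^T *m c' b) => mu v vE vc.
have: v *m invmx P^T = 0.
  apply: (sp mu) => [|b /vc]; last by rewrite mulmxA.
  rewrite !trmx_mul trmxK !mulmxA !(mulmxKV Ptu) vE.
  by rewrite -!scalemxAl.
by move/(congr1 (mulmx^~ P^T)); rewrite mulmxKV // mul0mx.
Qed.

Lemma block_spectrum (T1 T2 : finType) n1 n2 (E1 : 'M[k]_n1) (E2 : 'M[k]_n2)
    (lam1 : T1 -> k) (lam2 : T2 -> k) c1 c2 :
  pencil_spectrum E1 lam1 c1 -> pencil_spectrum E2 lam2 c2 ->
  pencil_spectrum (block_mx E1 0 0 E2)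
    (fun b : T1 + T2 => match b with inl b => lam1 b | inr b => lam2 b end)
    (fun b : T1 + T2 =>
       match b with inl b => col_mx (c1 b) 0 | inr b => col_mx 0 (c2 b) end).
Proof.
move=> sp1 sp2 mu v; rewrite -[v]hsubmxK; move: (lsubmx v) (rsubmx v) => v1 v2.
rewrite tr_block_mx !trmx0 !mul_row_block !mulmx0 !addr0 !add0r scale_row_mx.
move=> /eq_row_mx[e1 e2] vc.
suff [-> ->]: v1 = 0 /\ v2 = 0 by rewrite row_mx0.
split.
  apply: (sp1 mu) => // b lamb.
  by have := vc (inl b) lamb; rewrite mul_row_col mulmx0 addr0.
apply: (sp2 mu) => // b lamb.
by have := vc (inr b) lamb; rewrite mul_row_col mulmx0 add0r.
Qed.

(** The functional attached to [(i, t)] reads the [i]-th block of a row; the blocks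
    have different sizes, whence the cast. *)
Lemma mxdiag_spectrum (T : finType) s (n : 'I_s -> nat)
    (E : forall i, 'M[k]_(n i)) (lam : 'I_s -> T -> k) c :
  (forall i, pencil_spectrum (E i) (lam i) (c i)) ->
  pencil_spectrum (\mxdiag_i E i) (fun b : 'I_s * T => lam b.1 b.2)
    (fun b : 'I_s * T => \mxcol_i (if i =P b.1 is ReflectT e
        then castmx (congr1 n (esym e), erefl) (c b.1 b.2) else 0)).
Proof.
move=> sp mu v; rewrite -[v]submxrowK tr_mxdiag.
move: (fun i => submxrow v i) => {}v.
rewrite !mul_mxrow_mxdiag => vE vc.
suff v0 i : v i = 0.
  by rewrite -[RHS](submxrowK 0); apply: eq_mxrow => i; rewrite v0 submxrow0.
  apply: (sp i mu) => [|b lamb].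
    move/(congr1 (fun w => submxrow w i)): vE; rewrite mxrowK => ->.
    rewrite -[in RHS](mxrowK (fun i => v i *m (E i)^T)).
    by apply/matrixP=> a b; rewrite !mxE.
  have := vc (i, b) lamb; rewrite mul_mxrow_mxcol (bigD1 i) //= big1 => [|j ji].
    by case: eqP => // e; rewrite addr0 castmx_id.
  by case: eqP => [e|_]; rewrite ?mulmx0 //; rewrite e eqxx in ji.
Qed.

End PencilSpectrum.

(** * The blocks of the canonical form *)

Section CanonicalBlocks.
Variable k : fieldType.

(** A row read as a sequence which vanishes outside its range: the recurrences
    satisfied by eigenvectors then hold without boundary cases. *)
Definition row_nat n (v : 'rV[k]_n) (i : nat) : k :=
  if insub i is Some j then v 0 j else 0.

Lemma row_natE n (v : 'rV[k]_n) (j : 'I_n) : row_nat v j = v 0 j.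
Proof. by rewrite /row_nat valK. Qed.

Lemma row_nat_out n (v : 'rV[k]_n) i : (n <= i)%N -> row_nat v i = 0.
Proof. by move=> ni; rewrite /row_nat insubN // -leqNgt. Qed.

Lemma row_nat_eq0 n (v : 'rV[k]_n) :
  (forall i, (i < n)%N -> row_nat v i = 0) -> v = 0.
Proof. by move=> v0; apply/rowP => j; rewrite -row_natE v0 // mxE. Qed.

Lemma sum_row_nat n (v : 'rV[k]_n) (s : nat -> k) (m : nat) :
  \sum_(i < n) v 0 i * (if i == m :> nat then s i else 0) = row_nat v m * s m.
Proof.
under eq_bigr => i _ do rewrite -row_natE.
rewrite (eq_bigr (fun i : 'I_n => if i == m :> nat then row_nat v i * s i else 0)).
  rewrite -big_mkcond (big_ord1_eq +%R (fun i => row_nat v i * s i)).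
  by case: ltnP => // /(row_nat_out v) ->; rewrite mul0r.
by move=> i _; case: ifP; rewrite ?mulr0.
Qed.

Lemma sum_row_nat2 n (v : 'rV[k]_n) (s : nat -> k) (m1 m2 : nat) : m1 != m2 ->
  \sum_(i < n) v 0 i * (if (i == m1 :> nat) || (i == m2 :> nat) then s i else 0)
  = row_nat v m1 * s m1 + row_nat v m2 * s m2.
Proof.
move=> m12; rewrite -!sum_row_nat -big_split; apply: eq_bigr => i _ /=.
rewrite -mulrDr; congr (_ * _).
by case: eqP => [->|_]; rewrite ?(negbTE m12) ?addr0 ?add0r.
Qed.

Lemma mul_delta_col n (v : 'rV[k]_n) (i : 'I_n) :
  v *m delta_mx i (0 : 'I_1) = 0 -> row_nat v i = 0.
Proof. by rewrite -colE row_natE => /matrixP/(_ 0 0); rewrite !mxE. Qed.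

(** The columns are enumerated backwards because [J_mx] is supported around the
    antidiagonal. *)
Lemma mul_J_mx n (v : 'rV[k]_n.+1) (i : 'I_n.+1) :
  (v *m J_mx k n.+1) 0 (rev_ord i) =
  (-1) ^+ (n - i) * (row_nat v i - row_nat v i.+1).
Proof.
have ni : (i <= n)%N by rewrite -ltnS.
rewrite mxE (eq_bigr (fun l : 'I_n.+1 => v 0 l *
   (if (l == i :> nat) || (l == i.+1 :> nat) then (-1) ^+ (n - l) else 0))).
  rewrite (sum_row_nat2 v (fun l => (-1) ^+ (n - l))) ?neq_ltn ?leqnn //.
  move: ni; rewrite leq_eqVlt => /orP[/eqP ->|ni].
    by rewrite (row_nat_out v (leqnn _)) mul0r addr0 subr0 mulrC.
  have -> : (n - i = (n - i.+1).+1)%N by lia.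
  rewrite exprS; move: (row_nat _ _) (row_nat _ _) (_ ^+ _) => a b c; ring.
move=> l _; rewrite mxE subSS.
have -> // : (l + rev_ord i).+1 == n.+1 = (l == i :> nat) by rewrite /=; lia.
have -> // : (l + rev_ord i)%N == n.+1 = (l == i.+1 :> nat) by rewrite /=; lia.
Qed.

Lemma mul_J_mx_tr n (v : 'rV[k]_n.+1) (i : 'I_n.+1) :
  (v *m (J_mx k n.+1)^T) 0 (rev_ord i) =
  (-1) ^+ i * (row_nat v i + row_nat v i.+1).
Proof.
rewrite mxE (eq_bigr (fun l : 'I_n.+1 => v 0 l *
   (if (l == i :> nat) || (l == i.+1 :> nat) then (-1) ^+ i else 0))).
  rewrite (sum_row_nat2 v (fun=> (-1) ^+ i)) ?neq_ltn ?leqnn //.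
  by rewrite mulrDr ![_ * row_nat _ _]mulrC.
have ni : (i <= n)%N by rewrite -ltnS.
move=> l _; rewrite !mxE.
have -> : (n.+1 - (rev_ord i).+1 = i)%N by rewrite /=; lia.
have -> // : (rev_ord i + l).+1 == n.+1 = (l == i :> nat) by rewrite /=; lia.
have -> // : (rev_ord i + l)%N == n.+1 = (l == i.+1 :> nat) by rewrite /=; lia.
Qed.

(** With [nu = mu * (-1) ^+ n] the equation reads
    [(1 - nu) v_i = (1 + nu) v_(i+1)], where [v_(n+1) = 0].  If [nu] is not [1]
    this forces [v = 0] from the last entry down; if [nu = 1] it kills all entries
    but the first, as [2] is invertible. *)
Lemma J_spectrum n : (2%:R : k) != 0 ->
  pencil_spectrum (J_mx k n.+1) (fun _ : unit => (-1) ^+ n)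
    (fun=> delta_mx 0 0).
Proof.
move=> k2 mu v vJ vc; apply: row_nat_eq0.
have step i : (i <= n)%N ->
    (1 - mu * (-1) ^+ n) * row_nat v i = (1 + mu * (-1) ^+ n) * row_nat v i.+1.
  rewrite -ltnS => ltin; pose j := Ordinal ltin.
  move/matrixP/(_ 0 (rev_ord j)): vJ.
  rewrite mul_J_mx [in RHS]mxE mul_J_mx_tr [j : nat]/=.
  move/(congr1 ( *%R ((-1) ^+ (n - i)))).
  have -> : (-1) ^+ n = (-1) ^+ (n - i) * (-1) ^+ i :> k.
    by rewrite -exprD subnK.
  have : (-1) ^+ (n - i) * (-1) ^+ (n - i) = 1 :> k by rewrite -expr2 sqrr_sign.
  move: ((-1) ^+ (n - i)) ((-1) ^+ i) => a b aa e.
  have : row_nat v i - row_nat v i.+1 =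
      a * (mu * (b * (row_nat v i + row_nat v i.+1))).
    by rewrite -e mulrA aa mul1r.
  move: (row_nat v i) (row_nat v i.+1) => x y e'.
  apply/eqP; rewrite -subr_eq0.
  have -> : (1 - mu * (a * b)) * x - (1 + mu * (a * b)) * y =
    x - y - a * (mu * (b * (x + y))) by ring.
  by rewrite e' subrr.
have [mu1|mu1] := eqVneq (mu * (-1) ^+ n) 1.
  case=> [_|i ltin].
    apply: (@mul_delta_col _ _ 0); apply: (vc tt).
    by apply: (mulIf (x := (-1) ^+ n)); rewrite ?signr_eq0 // mu1 -expr2 sqrr_sign.
  have := step i (ltnW ltin); rewrite mu1 subrr mul0r => /esym/eqP.
  by rewrite mulf_eq0 -[1 + 1]/(2%:R) (negbTE k2) => /eqP.
move=> i lti; have [m le] := ubnP (n.+1 - i); elim: m i lti le => // m IH i lti le.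
apply/(mulfI (x := 1 - mu * (-1) ^+ n)); first by rewrite subr_eq0 eq_sym.
rewrite mulr0 step //; case: (ltnP i.+1 n.+1) => lt2.
  by rewrite IH ?mulr0 //; lia.
by rewrite row_nat_out ?mulr0.
Qed.

Lemma mul_B_mx r (q : k) (v : 'rV[k]_r) (j : 'I_r) :
  (v *m B_mx r q) 0 j =
  q * row_nat v j + (if j == 0%N :> nat then 0 else row_nat v j.-1).
Proof.
rewrite mxE.
rewrite (eq_bigr (fun l : 'I_r => v 0 l * (if l == j :> nat then q else 0)
   + v 0 l * (if l == j.-1 :> nat then (if j == 0%N :> nat then 0 else 1) else 0))).
  rewrite big_split /= (sum_row_nat v (fun=> q)).
  rewrite (sum_row_nat v (fun=> if j == 0%N :> nat then 0 else 1)) mulrC.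
  by case: ifP; rewrite ?mulr0 ?mulr1.
move=> l _; rewrite mxE -mulrDr; congr (_ * _); rewrite -val_eqE /=.
case: (nat_of_ord j) (nat_of_ord l) => [|j'] {}l /=; first by rewrite if_same addr0.
rewrite eqSS [j' == l]eq_sym; case: (l =P j'.+1) => [->|_]; last by rewrite add0r.
by rewrite gtn_eqF ?addr0.
Qed.

Lemma mul_B_mx_tr r (q : k) (v : 'rV[k]_r) (j : 'I_r) :
  (v *m (B_mx r q)^T) 0 j = q * row_nat v j + row_nat v j.+1.
Proof.
rewrite mxE.
rewrite (eq_bigr (fun l : 'I_r => v 0 l * (if l == j :> nat then q else 0)
   + v 0 l * (if l == j.+1 :> nat then 1 else 0))).
  rewrite big_split /= (sum_row_nat v (fun=> q)) (sum_row_nat v (fun=> 1)).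
  by rewrite mulrC mulr1.
move=> l _; rewrite !mxE -mulrDr; congr (_ * _); rewrite -val_eqE /= eq_sym.
by case: eqP => [->|_]; rewrite ?add0r // -[(_ == _.+1)]/(_ == _.+1) ltn_eqF ?addr0.
Qed.

(** For [v = (a, b)] the equation splits into [b B = mu b] and [a = mu a B^T]:
    an eigenvector of the Jordan block [B] for [mu] and, up to inverting [mu], one
    of its transpose.  The recurrences for [a] and [b] have no nonzero solution
    unless [mu * q = 1], respectively [mu = q], when one entry remains free. *)
Lemma D_spectrum r (q : k) :
  pencil_spectrum (D_mx r.+1 q) (fun b : bool => if b then q^-1 else q)
    (fun b : bool =>
       if b then col_mx (delta_mx 0 0) 0 else col_mx 0 (delta_mx ord_max 0)).
Proof.
move=> mu v; rewrite -[v]hsubmxK; move: (lsubmx v) (rsubmx v) => a b.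
rewrite /D_mx tr_block_mx !trmx0 trmx1 !mul_row_block !mulmx0 !mulmx1.
rewrite !addr0 !add0r scale_row_mx => /eq_row_mx[vB vA] vc.
suff [-> ->]: a = 0 /\ b = 0 by rewrite row_mx0.
split; apply: row_nat_eq0.
- have step (j : nat) : (j < r.+1)%N ->
      (1 - mu * q) * row_nat a j = mu * row_nat a j.+1.
    move=> ltj; move/matrixP/(_ 0 (Ordinal ltj)): vA.
    rewrite [in RHS]mxE mul_B_mx_tr -row_natE /= => e.
    by rewrite mulrBl mul1r {1}e; ring.
  have [mu1|mu1] := eqVneq (mu * q) 1.
    have mu0 : mu != 0.
      by apply: contra_eq_neq mu1 => ->; rewrite mul0r eq_sym oner_eq0.
    case=> [_|i lti].
      apply: (@mul_delta_col _ _ 0).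
      have := vc true; rewrite mul_row_col mulmx0 addr0; apply.
      by apply: (mulIf (x := q)); rewrite ?mu1 ?mulVf //;
         apply: contra_eq_neq mu1 => ->; rewrite mulr0 eq_sym oner_eq0.
    have := step i (ltnW lti); rewrite mu1 subrr mul0r => /esym/eqP.
    by rewrite mulf_eq0 (negbTE mu0) => /eqP.
  move=> i lti; have [m le] := ubnP (r.+1 - i); elim: m i lti le => // m IH i lti le.
  apply/(mulfI (x := 1 - mu * q)); first by rewrite subr_eq0 eq_sym.
  rewrite mulr0 step //; case: (ltnP i.+1 r.+1) => lt2.
    by rewrite IH ?mulr0 //; lia.
  by rewrite row_nat_out ?mulr0.
- have step (j : nat) : (j < r.+1)%N ->
      (mu - q) * row_nat b j = if j == 0%N then 0 else row_nat b j.-1.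
    move=> ltj; move/matrixP/(_ 0 (Ordinal ltj)): vB.
    by rewrite [in RHS]mxE mul_B_mx -row_natE /= mulrBl => <-; rewrite addrC addKr.
  have [muq|muq] := eqVneq mu q.
    move=> i; rewrite ltnS leq_eqVlt => /orP[/eqP ->|lti].
      apply: (@mul_delta_col _ _ ord_max).
      by have := vc false; rewrite mul_row_col mulmx0 add0r; apply.
    by have := step i.+1 lti; rewrite muq subrr mul0r.
  elim=> [|i IH] lti; apply/(mulfI (x := mu - q)); rewrite ?subr_eq0 // mulr0.
    exact: step.
  by rewrite step //= IH // ltnW.
Qed.

End CanonicalBlocks.

(** * Powers of a cosquare are nonderogatory *)

Section CanonicalSpectrum.
Variable k : fieldType.

Lemma D_spectrum_gt0 r (q : k) : (0 < r)%N ->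
  exists c, pencil_spectrum (D_mx r q) (fun b : bool => if b then q^-1 else q) c.
Proof. by case: r => // r _; eexists; apply: D_spectrum. Qed.

Lemma Dsum_spectrum s (r : 'I_s -> nat) (q : 'I_s -> k) :
  (forall i, 0 < r i)%N ->
  exists c, pencil_spectrum (Dsum_mx r q)
    (fun b : 'I_s * bool => if b.2 then (q b.1)^-1 else q b.1) c.
Proof.
move=> r_gt0.
have [c spc] := fin_all_exists (fun i => D_spectrum_gt0 (q i) (r_gt0 i)).
by eexists; apply: (mxdiag_spectrum spc).
Qed.

Lemma distinct_with_inverses_inj s (x : 'I_s -> k) :
  distinct_with_inverses x ->
  injective (fun b : 'I_s * bool => if b.2 then (x b.1)^-1 else x b.1).
Proof.
rewrite /distinct_with_inverses; set f := fun b : 'I_s * bool => _.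
set pairs := [seq (i, b) | i <- enum 'I_s, b <- [:: false; true]].
have -> : flatten [seq [:: x i; (x i)^-1] | i <- enum 'I_s] = map f pairs.
  by rewrite /pairs; elim: (enum 'I_s) => //= i e ->.
have enum_pairs : perm_eq (enum {: 'I_s * bool}) pairs.
  apply: uniq_perm; first exact: enum_uniq.
    by rewrite allpairs_uniq ?enum_uniq // => -[? ?] [].
  move=> [i b]; rewrite mem_enum; apply/esym/allpairsP.
  by exists (i, b); rewrite mem_enum; case: b.
by rewrite -(perm_uniq (perm_map f enum_pairs)) => /injectiveP.
Qed.

(** The eigenvalue [(-1) ^+ n] of a block [J_n.+1] cannot collide with the others:
    if [q ^+ j] or its inverse were a sign, it would be its own inverse, whereas
    [q ^+ j] and its inverse are distinct entries of the list. *)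
Lemma canonical_spectrum (k_2 : (2%:R : k) != 0) N (E : 'M[k]_N)
    s (r : 'I_s -> nat) (q : 'I_s -> k) (j : nat) :
  (forall i, 0 < r i)%N -> distinct_with_inverses (fun i => q i ^+ j) ->
  (exists (n : nat) (eN : (n + \sum_(i < s) (r i + r i))%N = N),
      (0 < n)%N /\ congruent E (castmx (eN, eN) (JDsum_mx n r q)))
  \/ (exists eN : (\sum_(i < s) (r i + r i))%N = N,
        congruent E (castmx (eN, eN) (Dsum_mx r q))) ->
  exists (T : finType) (lam : T -> k) (c : T -> 'cV[k]_N),
    pencil_spectrum E lam c /\ injective (fun b => lam b ^+ j).
Proof.
move=> r_gt0 /distinct_with_inverses_inj q_inj E_form.
pose lamD (b : 'I_s * bool) := if b.2 then (q b.1)^-1 else q b.1.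
have lamDX b : lamD b ^+ j = if b.2 then (q b.1 ^+ j)^-1 else q b.1 ^+ j.
  by rewrite /lamD; case: ifP => // _; rewrite exprVn.
have lamD_inj : injective (fun b => lamD b ^+ j).
  by move=> b b'; rewrite !lamDX => /q_inj.
have [cD spD] := Dsum_spectrum q r_gt0.
case: E_form => [[n [eN [n_gt0 EJ]]]|[eN EJ]]; last first.
  case: _ / eN E EJ => E; rewrite castmx_id => EJ.
  by have [c spc] := congruent_spectrum EJ spD; exists ('I_s * bool)%type, lamD, c.
case: _ / eN E EJ => E; rewrite castmx_id; case: n n_gt0 E => // n _ E EJ.
have [c spc] := congruent_spectrum EJ (block_spectrum (J_spectrum (n := n) k_2) spD).
eexists _, _, c; split; first exact: spc.
have notJ b : lamD b ^+ j != ((-1) ^+ n) ^+ j.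
  apply/eqP => bJ; have : lamD b ^+ j * lamD b ^+ j = 1.
    by rewrite bJ -exprMn -expr2 sqrr_sign expr1n.
  case: b {bJ} => i b; rewrite lamDX => sq1.
  suff : (i, ~~ b) = (i, b) by case: (b).
  apply: lamD_inj; rewrite !lamDX; case: b sq1 => /= /mulr1_eq // e.
  by rewrite invrK in e.
case=> [[]|b] [[]|b'] //=.
- by move=> e; have := notJ b'; rewrite -e eqxx.
- by move=> e; have := notJ b; rewrite e eqxx.
by move=> /lamD_inj ->.
Qed.

Definition nonderogatory N (M : 'M[k]_N) : Prop :=
  forall mu : k, (N <= (\rank (M - mu%:M)%R).+1)%N.

(** The kernel of [A] embeds into the base field through [c]. *)
Lemma rank_ge_functional N (A : 'M[k]_N) (c : 'cV[k]_N) :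
  (forall v : 'rV_N, v *m A = 0 -> v *m c = 0 -> v = 0) -> (N <= (\rank A).+1)%N.
Proof.
move=> kerA; rewrite -addn1 -leq_subLR -mxrank_ker.
rewrite -(mxrank_mul_ker (kermx A) c).
have -> : (kermx A :&: kermx c)%MS = 0.
  apply/eqP; rewrite -submx0; apply/rV_subP => v.
  by rewrite sub_capmx !sub_kermx => /andP[/eqP vA /eqP vc]; rewrite (kerA v) ?sub0mx.
by rewrite mxrank0 addn0 rank_leq_col.
Qed.

End CanonicalSpectrum.

Section CosquarePower.
Variable k : closedFieldType.

Lemma Xn_sub_const_split (j : nat) (mu : k) : (j%:R : k) != 0 -> mu != 0 ->
  exists2 zs : seq k, uniq zs & 'X^j - mu%:P = \prod_(z <- zs) ('X - z%:P).
Proof.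
move=> j0 mu0.
have jn0 : (0 < j)%N by case: j j0 => //; rewrite eqxx.
have [zs pE] := closed_field_poly_normal ('X^j - mu%:P : {poly k}).
have lc1 : lead_coef ('X^j - mu%:P : {poly k}) = 1.
  by apply/eqP; rewrite -[_ == _]/('X^j - mu%:P \is monic) monicXnsubC.
rewrite lc1 scale1r in pE; exists zs => //.
rewrite -separable_prod_XsubC -pE separable_poly.unlock derivB derivC subr0 derivXn.
apply/Bezout_eq1_coprimepP.
exists (- mu^-1%:P, (mu^-1 / j%:R) *: 'X) => /=.
rewrite -scaler_nat -scalerAl scalerAr scalerA divfK //.
rewrite mulNr mulrBr -polyCM mulVf // opprB -scalerAr -exprS prednK //.
by rewrite mul_polyC subrK.
Qed.

(** In [M ^+ j - mu = \prod_(z ^+ j = mu) (M - z)] the roots [z] are distinct, so by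
    injectivity of [lam b ^+ j] at most one factor is singular, and that factor
    has a kernel of dimension at most one. *)
Lemma nonderogatory_cosquareX N (E : 'M[k]_N) (T : finType) (lam : T -> k)
    (c : T -> 'cV[k]_N) (j : nat) :
  (j%:R : k) != 0 -> E \in unitmx -> pencil_spectrum E lam c ->
  injective (fun b => lam b ^+ j) ->
  nonderogatory ((E *m (invmx E)^T) ^+ j).
Proof.
case: N E c => // N E c j0 Eu sp lam_inj mu; set M := E *m _.
have Etu : E^T \in unitmx by rewrite unitmx_tr.
have Mu : M \in unitmx by rewrite unitmx_mul Eu unitmx_tr unitmx_inv.
have [->|mu0] := eqVneq mu 0.
  rewrite raddf0 subr0 mxrank_unit //.
  by rewrite -[_ \in _]/(M ^+ j \is a GRing.unit) unitrX.
have eigM (z : k) (v : 'rV_N.+1) : v *m (M - z%:M) = 0 -> v *m E = z *: (v *m E^T).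
  rewrite mulmxBr mul_mx_scalar => /eqP; rewrite subr_eq0 => /eqP vM.
  by rewrite scalemxAl -vM /M trmx_inv !mulmxA mulmxKV.
have eig_lam (z : k) : M - z%:M \notin unitmx -> exists b, lam b = z.
  move=> Mz; apply/not_existsP => lamz; case/negP: Mz.
  rewrite -row_free_unit -kermx_eq0; apply/eqP/row_matrixP => i; rewrite row0.
  apply: (sp z) => [|b /lamz//]; apply: eigM.
  by apply/sub_kermxP/row_sub.
have [zs zs_uniq pE] := Xn_sub_const_split j0 mu0.
have zsX z : z \in zs -> z ^+ j = mu.
  rewrite -root_prod_XsubC -pE => /rootP; rewrite !hornerE.
  by move/eqP; rewrite subr_eq0 => /eqP.
have hornerM (p : {poly k}) : 'X^j - mu%:P = p -> M ^+ j - mu%:M = horner_mx M p.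
  by move=> <-; rewrite rmorphB rmorphXn /= horner_mx_X horner_mx_C.
have hornerXz z : horner_mx M ('X - z%:P) = M - z%:M.
  by rewrite rmorphB /= horner_mx_X horner_mx_C.
have prod_unit (s : seq k) : (forall z, z \in s -> M - z%:M \in unitmx) ->
    horner_mx M (\prod_(z <- s) ('X - z%:P)) \in unitmx.
  elim: s => [|z s IH] su; first by rewrite big_nil rmorph1 unitmx1.
  rewrite big_cons rmorphM /= hornerXz unitmx_mul su ?mem_head // IH // => z' z's.
  by apply: su; rewrite inE z's orbT.
case: (boolP (all (fun z => M - z%:M \in unitmx) zs)) => [/allP zsu|].
  by rewrite (hornerM _ pE) mxrank_unit // prod_unit.
move=> /allPn[z zzs /eig_lam[b lamb]].
rewrite (perm_big _ (perm_to_rem zzs)) big_cons in pE.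
rewrite (hornerM _ pE) rmorphM /= hornerXz mxrankMfree; last first.
  rewrite row_free_unit prod_unit // => z'.
  rewrite mem_rem_uniq // => /andP[/= z'z z'zs].
  apply: contraNT z'z => /eig_lam[b' lamb']; rewrite -lamb -lamb'.
  by apply/eqP; congr lam; apply: lam_inj; rewrite lamb lamb' !zsX.
apply: (rank_ge_functional (c := c b)) => v /eigM vE vc.
apply: (sp z) => // b' lamb'; suff -> : b' = b by [].
by apply: lam_inj; rewrite lamb lamb'.
Qed.

End CosquarePower.

(** * Jordan chains *)

Section Chains.
Variables (k : fieldType) (N : nat).

Definition chain (A : 'M[k]_N) (v : 'rV[k]_N) m : 'M[k]_(m, N) :=
  \matrix_(i < m) (v *m A ^+ i).

Lemma rank_expr_ge (A : 'M[k]_N) m :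
  (N <= (\rank A).+1)%N -> (N <= \rank (A ^+ m)%R + m)%N.
Proof.
move=> Ar; elim: m => [|m IH]; first by rewrite expr0 mxrank1 addn0.
have := mxrank_mul_min A (A ^+ m); rewrite exprS -[A * _]/(A *m _).
lia.
Qed.

Lemma chain_row_free (A : 'M[k]_N) (v : 'rV[k]_N) m :
  v *m A ^+ m.+1 = 0 -> v *m A ^+ m != 0 -> row_free (chain A v m.+1).
Proof.
move=> vA0 vA; rewrite -kermx_eq0; apply/eqP/row_matrixP => a; rewrite row0.
have : row a (kermx (chain A v m.+1)) *m chain A v m.+1 = 0.
  by apply/sub_kermxP/row_sub.
move: (row a _) => x; rewrite mulmx_sum_row => xW; apply/rowP => i; rewrite mxE.
have vA_ge t : (m < t)%N -> v *m A ^+ t = 0.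
  by move=> mt; rewrite -(subnKC mt) exprD -[_ * _]/(_ *m _) mulmxA vA0 mul0mx.
have [n le_n] := ubnP (i : nat); elim: n i le_n => // n IH i le_n.
move/(congr1 (mulmx^~ (A ^+ (m - i)))): xW; rewrite mulmx_suml mul0mx.
rewrite (bigD1 i) //= big1 => [|t ti].
  rewrite rowK addr0 -scalemxAl -mulmxA -[_ *m A ^+ (m - i)]/(_ * _) -exprD.
  by rewrite subnKC -1?ltnS // => /eqP; rewrite scaler_eq0 (negbTE vA) orbF => /eqP.
rewrite rowK; case: (ltngtP t i) => [lt|gt|/val_inj e]; last by rewrite e eqxx in ti.
  by rewrite IH ?scale0r ?mul0mx // (leq_trans lt).
rewrite -scalemxAl -mulmxA -[_ *m A ^+ (m - i)]/(_ * _) -exprD vA_ge ?scaler0 //.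
have := ltn_ord i; lia.
Qed.

(** The chain spans a space of dimension [m.+1] inside the kernel, whose dimension
    is at most [m.+1] since each factor [A] loses at most one dimension. *)
Lemma ker_sub_chain (A : 'M[k]_N) (v : 'rV[k]_N) m :
  (N <= (\rank A).+1)%N -> v *m A ^+ m.+1 = 0 -> v *m A ^+ m != 0 ->
  (kermx (A ^+ m.+1)%R <= chain A v m.+1)%MS.
Proof.
move=> Ar vA0 vA; have Wfree := chain_row_free vA0 vA.
have Wker : (chain A v m.+1 <= kermx (A ^+ m.+1)%R)%MS.
  apply/sub_kermxP/row_matrixP => i; rewrite row_mul rowK row0 -mulmxA.
  rewrite -[_ *m A ^+ m.+1]/(_ * _) -exprD addnC exprD -[_ * _]/(_ *m _) mulmxA.
  by rewrite vA0 mul0mx.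
rewrite -(geq_leqif (mxrank_leqif_sup Wker)) (eqP Wfree) mxrank_ker leq_subLR.
exact: rank_expr_ge.
Qed.
End Chains.

(** Every row is a sum of generalized eigenvectors: split off one root of a
    polynomial annihilating the row at a time by a Bezout relation. *)
Lemma primary_ind (k : closedFieldType) N (M : 'M[k]_N)
    (Q : 'rV[k]_N -> Prop) :
  Q 0 -> (forall v w, Q v -> Q w -> Q (v + w)) ->
  (forall z m v, v *m (M - z%:M) ^+ m = 0 -> Q v) -> forall v, Q v.
Proof.
case: N M Q => [|N] M Q Q0 QD Qprim v; first by rewrite thinmx0.
have key n (p : {poly k}) w : (size p <= n)%N -> p != 0 ->
    w *m horner_mx M p = 0 -> Q w.
  elim: n p w => [|n IH] p w.
    by rewrite leqn0 size_poly_eq0 => /eqP ->; rewrite eqxx.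
  move=> sp p0 wp; have [sp1|sp1] := eqVneq (size p) 1%N.
    have [c c0 pE] := size_poly1P _ (introT eqP sp1).
    move: wp; rewrite pE horner_mx_C mul_mx_scalar => /eqP.
    by rewrite scaler_eq0 (negbTE c0) => /eqP ->.
  have [z pz] := closed_rootP _ sp1.
  have [m [u /implyP/(_ p0) uz pE]] := multiplicity_XsubC p z.
  have m0 : (0 < m)%N.
    by case: m pE => // pE; move: uz; rewrite -[u]mulr1 -(expr0 ('X - z%:P)) -pE pz.
  have u0 : u != 0 by apply: contraNneq p0 => u0; rewrite pE u0 mul0r.
  have : coprimep u (('X - z%:P) ^+ m).
    by apply: coprimep_expr; rewrite coprimep_XsubC.
  case/Bezout_eq1_coprimepP=> -[a b] /= ab.
  have -> : w = w *m horner_mx M (a * u) + w *m horner_mx M (b * ('X - z%:P) ^+ m).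
    by rewrite -mulmxDr -rmorphD /= ab rmorph1 mulmx1.
  have horner_comm (f g : {poly k}) :
      w *m horner_mx M f *m horner_mx M g = w *m horner_mx M (f * g).
    by rewrite rmorphM -mulmxA.
  apply: QD.
    apply: (Qprim z m).
    have -> : (M - z%:M) ^+ m = horner_mx M (('X - z%:P) ^+ m).
      by rewrite rmorphXn rmorphB /= horner_mx_X horner_mx_C.
    by rewrite horner_comm -mulrA -pE mulrC -horner_comm wp mul0mx.
  apply: (IH u) => //; last first.
    by rewrite horner_comm -mulrA [_ * u]mulrC -pE mulrC -horner_comm wp mul0mx.
  rewrite -ltnS; apply: leq_trans sp; rewrite pE size_Mmonic ?monic_exp ?monicXsubC //.
  rewrite size_exp_XsubC addnS /= -[X in (X < _)%N]addn0 ltn_add2l //.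
apply: (key _ (char_poly M) v (leqnn _)); first exact/monic_neq0/char_poly_monic.
by rewrite Cayley_Hamilton mulmx0.
Qed.

(** * Comatrices in a Hopf algebra *)

Section TensorTools.
Variable k : fieldType.

Lemma tlift_sum (V W X : lmodType k) (f : V -> W -> X) (I : Type) (s : seq I)
    (P : pred I) (x : I -> V) (y : I -> W) :
  bilinear_for *:%R *:%R f ->
  tlift f (\sum_(l <- s | P l) x l \ox y l) = \sum_(l <- s | P l) f (x l) (y l).
Proof.
move=> bf; have [lin_f fE] := tlift_bilinear bf.
pose F : {linear tensor V W -> X} :=
  HB.pack (tlift f) (GRing.isLinear.Build k _ _ *:%R (tlift f) lin_f).
rewrite (linear_sum F); apply: eq_bigr => l _; exact: fE.
Qed.

Lemma tens_suml (V W : lmodType k) (I : Type) (s : seq I)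
    (P : pred I) (x : I -> V) (y : W) :
  (\sum_(l <- s | P l) x l) \ox y = \sum_(l <- s | P l) x l \ox y.
Proof.
apply: (big_morph (fun x => x \ox y) (fun a b => tensDl a b y)).
by rewrite -(scale0r 0) tensZl scale0r.
Qed.

Lemma tens_sumr (V W : lmodType k) (I : Type) (s : seq I)
    (P : pred I) (x : V) (y : I -> W) :
  x \ox (\sum_(l <- s | P l) y l) = \sum_(l <- s | P l) x \ox y l.
Proof.
apply: (big_morph (tens x) (tensDr x)).
by rewrite -(scale0r 0) tensZr scale0r.
Qed.

(** The contraction of the left tensor factor by [phi]. *)
Definition tcoef (V W : lmodType k) (phi : V -> k) : tensor V W -> W :=
  tlift (fun v w => phi v *: w).

Section Tcoef.
Variables (V W : lmodType k) (phi : {scalar V}).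

Let tcoef_bil : bilinear_for *:%R *:%R (fun (v : V) (w : W) => phi v *: w).
Proof.
split=> [w a v v'|v a w w'] /=; first by rewrite linearP scalerDl scalerA.
by rewrite scalerDr !scalerA mulrC.
Qed.

Lemma tcoefE v (w : W) : tcoef phi (v \ox w) = phi v *: w.
Proof. exact: (tlift_bilinear tcoef_bil).2. Qed.

Lemma tcoef_is_linear : linear (tcoef phi : tensor V W -> W).
Proof. exact: (tlift_bilinear tcoef_bil).1. Qed.
HB.instance Definition _ :=
  GRing.isLinear.Build k (tensor V W) W *:%R (tcoef phi) tcoef_is_linear.

End Tcoef.
End TensorTools.

Section Comatrix.
Variables (k : fieldType) (H : hopfAlgType k).

(** The matrix of coefficients of a finite dimensional comodule.  The index set is a
    finite type rather than an ordinal so that the product of two comatrices is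
    indexed by pairs. *)
Definition comatrix (I : finType) (Z : I -> I -> H) : Prop :=
  forall i j, comul (Z i j) = \sum_l Z i l \ox Z l j /\
              counit (Z i j) = (i == j)%:R.

Lemma comatrix_antipodel (I : finType) (Z : I -> I -> H) i j : comatrix Z ->
  \sum_l antipode (Z i l) * Z l j = (i == j)%:R.
Proof.
move=> cZ; have := antipodel (Z i j); rewrite (cZ i j).1 (cZ i j).2 scaler_nat => <-.
rewrite tlift_sum //.
split=> [u a x y|u a x y] /=; first by rewrite linearP mulrDl scalerAl.
by rewrite mulrDr scalerAr.
Qed.

Lemma comatrix_antipoder (I : finType) (Z : I -> I -> H) i j : comatrix Z ->
  \sum_l Z i l * antipode (Z l j) = (i == j)%:R.
Proof.
move=> cZ; have := antipoder (Z i j); rewrite (cZ i j).1 (cZ i j).2 scaler_nat => <-.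
rewrite tlift_sum //.
split=> [u a x y|u a x y] /=; first by rewrite mulrDl scalerAl.
by rewrite linearP mulrDr scalerAr.
Qed.

End Comatrix.

Lemma two_sided_inverse_uniq (R : pzRingType) (I : finType) (A B C : I -> I -> R) :
  (forall i j, \sum_l A i l * B l j = (i == j)%:R) ->
  (forall i j, \sum_l B i l * C l j = (i == j)%:R) ->
  forall i j, A i j = C i j.
Proof.
move=> AB BC i j.
transitivity (\sum_l \sum_m A i l * B l m * C m j).
  rewrite [LHS](_ : _ = \sum_l A i l * (l == j)%:R).
    apply: eq_bigr => l _; rewrite -BC mulr_sumr.
    by apply: eq_bigr => m _; rewrite mulrA.
  rewrite (bigD1 j) //= eqxx mulr1 big1 ?addr0 // => l /negbTE ->.
  by rewrite mulr0.
rewrite exchange_big (bigD1 i) //= [X in _ + X]big1 => [|m mi].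
  by rewrite -mulr_suml AB eqxx mul1r addr0.
by rewrite -mulr_suml AB eq_sym (negbTE mi) mul0r.
Qed.

Section ComatrixTheory.
Variables (k : fieldType) (H : hopfAlgType k).

Lemma comatrix_mul (I J : finType) (Y : I -> I -> H) (Z : J -> J -> H) :
  comatrix Y -> comatrix Z ->
  comatrix (fun p q : I * J => Y p.1 q.1 * Z p.2 q.2).
Proof.
move=> cY cZ [i i'] [j j'] /=.
have [_ comulM] := @comul_monoid_morphism k H.
have [_ counitM] := @counit_monoid_morphism k H.
rewrite comulM counitM (cY i j).1 (cY i j).2 (cZ i' j').1 (cZ i' j').2; split.
  rewrite mulr_suml -(pair_bigA _ (fun l l' =>
    (Y i l * Z i' l') \ox (Y l j * Z l' j'))) /=.
  apply: eq_bigr => l _; rewrite mulr_sumr.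
  by apply: eq_bigr => l' _; rewrite tensM.
by rewrite -natrM mulnb xpair_eqE.
Qed.

(** Both sides are entries of an inverse of the product comatrix. *)
Lemma antipode_comatrixM (I J : finType) (Y : I -> I -> H) (Z : J -> J -> H)
    i j i' j' :
  comatrix Y -> comatrix Z ->
  antipode (Y i j * Z i' j') = antipode (Z i' j') * antipode (Y i j).
Proof.
move=> cY cZ; pose P (p q : I * J) := Y p.1 q.1 * Z p.2 q.2.
apply: (@two_sided_inverse_uniq H (I * J)%type (fun p q => antipode (P p q)) P
  (fun p q => antipode (Z p.2 q.2) * antipode (Y p.1 q.1)) _ _ (i, i') (j, j')) => p q.
  exact/comatrix_antipodel/comatrix_mul.
rewrite -(pair_bigA _ (fun l m =>
  Y p.1 l * Z p.2 m * (antipode (Z m q.2) * antipode (Y l q.1)))) /=.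
transitivity (\sum_l Y p.1 l * (p.2 == q.2)%:R * antipode (Y l q.1)).
  apply: eq_bigr => l _; rewrite -(comatrix_antipoder _ _ cZ) mulr_sumr mulr_suml.
  by apply: eq_bigr => m _; rewrite !mulrA.
transitivity (\sum_l (Y p.1 l * antipode (Y l q.1)) * (p.2 == q.2)%:R).
  by apply: eq_bigr => l _; case: eqP => _; rewrite ?mulr1 ?mulr0 ?mul0r.
rewrite -mulr_suml (comatrix_antipoder _ _ cY) -natrM mulnb -xpair_eqE.
by rewrite -!surjective_pairing.
Qed.

(** The matrices [Delta (S (Z))] and [\sum_l S(Z_lj) (x) S(Z_il)] are both inverse to
    [Delta (Z)] over the ring [tensor H H]. *)
Lemma antipode_comatrix (I : finType) (Z : I -> I -> H) :
  comatrix Z -> comatrix (fun i j => antipode (Z j i)).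
Proof.
move=> cZ i j; have [comul1 comulM] := @comul_monoid_morphism k H.
have [counit1 counitM] := @counit_monoid_morphism k H.
have comulR (b : bool) : comul (b%:R : H) = b%:R.
  by case: b; rewrite ?comul1 ?linear0.
split.
  apply: (@two_sided_inverse_uniq _ I (fun i j => comul (antipode (Z i j)))
    (fun i j => comul (Z i j))
    (fun i j => \sum_l antipode (Z l j) \ox antipode (Z i l))) => {}i {}j.
    rewrite -comulR -(comatrix_antipodel _ _ cZ) linear_sum.
    by apply: eq_bigr => l _; rewrite comulM.
  transitivity (\sum_m \sum_l \sum_n
      (Z i m * antipode (Z n j)) \ox (Z m l * antipode (Z l n))).
    rewrite exchange_big; apply: eq_bigr => l _ /=.
    rewrite (cZ i l).1 mulr_suml; apply: eq_bigr => m _.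
    by rewrite mulr_sumr; apply: eq_bigr => n _; rewrite tensM.
  transitivity (\sum_m \sum_n
      (Z i m * antipode (Z n j)) \ox ((m == n)%:R : H)).
    apply: eq_bigr => m _; rewrite exchange_big; apply: eq_bigr => n _ /=.
    by rewrite -tens_sumr (comatrix_antipoder _ _ cZ).
  transitivity (\sum_m (Z i m * antipode (Z m j)) \ox (1 : H)).
    apply: eq_bigr => m _; rewrite (bigD1 m) //= eqxx big1 ?addr0 // => n nm.
    by rewrite eq_sym (negbTE nm) mulr0n -(scale0r (0 : H)) tensZr scale0r.
  rewrite -tens_suml (comatrix_antipoder _ _ cZ); case: eqP => _ //.
  by rewrite mulr0n -(scale0r (0 : H)) tensZl scale0r.
have := congr1 counit (comatrix_antipodel j i cZ).
rewrite linear_sum (eq_bigr (fun l => counit (antipode (Z j l)) * (l == i)%:R)).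
  rewrite (bigD1 i) //= eqxx mulr1 big1 ?addr0 => [->|l /negbTE ->].
    by rewrite eq_sym; case: eqP => _; rewrite ?counit1 ?linear0.
  by rewrite mulr0.
by move=> l _; rewrite counitM (cZ l i).2.
Qed.

End ComatrixTheory.

(** * Inner faithfulness as an induction principle *)

Section TensSub.
Variables (k : fieldType) (V W : lmodType k) (P : set V) (Q : set W).

Lemma tens_sub0 : tens_sub P Q 0.
Proof. by exists [::]; split; rewrite // big_nil. Qed.

Lemma tens_sub_tens v w : P v -> Q w -> tens_sub P Q (v \ox w).
Proof.
move=> Pv Qw; exists [:: (v, w)]; split; last by rewrite big_seq1.
by move=> p; rewrite inE => /eqP ->.
Qed.

Lemma tens_subD t u : tens_sub P Q t -> tens_sub P Q u -> tens_sub P Q (t + u).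
Proof.
move=> [s1 [H1 ->]] [s2 [H2 ->]]; exists (s1 ++ s2); split; last by rewrite big_cat.
by move=> p; rewrite mem_cat => /orP[/H1|/H2].
Qed.

Lemma tens_sub_sum (I : Type) (s : seq I) (R : pred I) (F : I -> tensor V W) :
  (forall i, R i -> tens_sub P Q (F i)) -> tens_sub P Q (\sum_(i <- s | R i) F i).
Proof. move=> H; elim/big_ind: _ => //; [exact: tens_sub0|exact: tens_subD]. Qed.

Lemma tens_subZ a t : (forall v, P v -> P (a *: v)) -> tens_sub P Q t ->
  tens_sub P Q (a *: t).
Proof.
move=> PZ [s [Hs ->]]; rewrite scaler_sumr big_seq; apply: tens_sub_sum => p /Hs[Pp Qp].
by rewrite -tensZl; apply: tens_sub_tens => //; apply: PZ.
Qed.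

End TensSub.

Section Generation.
Variables (k : fieldType) (H : hopfAlgType k).

Variable P : set H.
Hypothesis P1 : P 1.
Hypothesis PM : forall x y, P x -> P y -> P (x * y).
Hypothesis PS : forall (J : finType) (Z : J -> J -> H), comatrix Z ->
  (forall i j, P (Z i j)) -> forall i j, P (antipode (Z i j)).

Definition comatrix_coeff : set H := fun x =>
  exists (J : finType) (Z : J -> J -> H) i j,
    [/\ comatrix Z, forall i j, P (Z i j) & x = Z i j].

(** Comatrices are closed under products and under the transposed antipode, so their
    coefficients span a Hopf subalgebra; [P] cuts out a class of comatrices stable
    under these operations. *)
Lemma comatrix_coeff_hopf : hopf_subalgebra [set h | h \in lin_span comatrix_coeff].
Proof.
have [comul1 comulM] := @comul_monoid_morphism k H.
have [counit1 counitM] := @counit_monoid_morphism k H.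
split.
- apply: lin_span_gen; exists unit, (fun _ _ => 1), tt, tt; split=> // i j.
  by rewrite comul1 counit1 big_const card_unit /= addr0; case: i; case: j.
- by move=> a x y /= Bx By; rewrite rpredD // rpredZ.
- move=> x y /= Bx; elim/lin_span_ind: y / => [|a y y' By By'|y].
  + by rewrite mulr0 rpred0.
  + by rewrite mulrDr -scalerAr rpredD // rpredZ.
  move=> [J [Z [i [j [cZ PZ ->]]]]]; elim/lin_span_ind: x / Bx => [|a x x' Bx Bx'|x].
  + by rewrite mul0r rpred0.
  + by rewrite mulrDl -scalerAl rpredD // rpredZ.
  move=> [J' [Z' [i' [j' [cZ' PZ' ->]]]]]; apply: lin_span_gen.
  exists (J' * J)%type, (fun p q => Z' p.1 q.1 * Z p.2 q.2), (i', i), (j', j).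
  by split=> // [|p q]; [exact: comatrix_mul|apply: PM].
- move=> x /=; elim/lin_span_ind: x / => [|a x y Bx By|x].
  + by rewrite linear0; apply: tens_sub0.
  + rewrite linearP; apply: tens_subD => //; apply: tens_subZ => // v /= Bv.
    by rewrite rpredZ.
  move=> [J [Z [i [j [cZ PZ ->]]]]]; rewrite (cZ i j).1; apply: tens_sub_sum => l _.
  apply: tens_sub_tens => /=; apply: lin_span_gen; first by exists J, Z, i, l.
  by exists J, Z, l, j.
- move=> x /=; elim/lin_span_ind: x / => [|a x y Bx By|x].
  + by rewrite linear0 rpred0.
  + by rewrite linearP rpredD // rpredZ.
  move=> [J [Z [i [j [cZ PZ ->]]]]]; apply: lin_span_gen.
  exists J, (fun i j => antipode (Z j i)), j, i; split=> // [|i' j'].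
    exact: antipode_comatrix.
  exact: PS.
Qed.

End Generation.

Section InnerFaithful.
Variables (k : fieldType) (H : hopfAlgType k) (A : algType k).
Variables (rho : {linear A -> tensor A H}) (I : finType) (Y : I -> I -> H).
Hypothesis rho_faithful : inner_faithful rho.
Hypothesis cY : comatrix Y.
Hypothesis rhoY : forall B : set H, hopf_subalgebra B -> (forall i j, B (Y i j)) ->
  (range rho `<=` tens_sub setT B)%classic.

Lemma inner_faithful_gen (P : set H) : P 1 ->
  (forall x y, P x -> P y -> P (x * y)) ->
  (forall (J : finType) (Z : J -> J -> H), comatrix Z ->
    (forall i j, P (Z i j)) -> forall i j, P (antipode (Z i j))) ->
  (forall i j, P (Y i j)) -> forall h, h \in lin_span (comatrix_coeff P).
Proof.
move=> P1 PM PS PY h; apply/negP => /negP nh.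
have hB := comatrix_coeff_hopf P1 PM PS.
apply: (rho_faithful hB).
  by split=> // /(_ h Logic.I) /= hh; move: nh; rewrite hh.
apply: rhoY => // i j; apply: lin_span_gen.
by exists I, Y, i, j.
Qed.

(** An element in the span of coefficients of comatrices whose entries all satisfy [P]
    satisfies [P] itself when [P] is a subspace. *)
Lemma inner_faithful_ind (P : set H) : P 0 ->
  (forall a x y, P x -> P y -> P (a *: x + y)) -> P 1 ->
  (forall x y, P x -> P y -> P (x * y)) ->
  (forall (J : finType) (Z : J -> J -> H), comatrix Z ->
    (forall i j, P (Z i j)) -> forall i j, P (antipode (Z i j))) ->
  (forall i j, P (Y i j)) -> forall h, P h.
Proof.
move=> P0 Plin P1 PM PS PY h; have := inner_faithful_gen P1 PM PS PY h.
by elim/lin_span_ind: h / => // h [J [Z [i [j [_ PZ ->]]]]].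
Qed.

(** By inner faithfulness every element of [H] is a combination of coefficients of
    comatrices, and for these the antipode is antimultiplicative by uniqueness of
    inverse matrices. *)
Lemma antipodeM (x y : H) : antipode (x * y) = antipode y * antipode x.
Proof.
have gen h : h \in lin_span (comatrix_coeff (setT : set H)).
  by apply: inner_faithful_gen.
elim/lin_span_ind: x / (gen x) => [|a x x' ex ex'|x].
- by rewrite mul0r linear0 mulr0.
- by rewrite mulrDl -scalerAl !linearP /= ex ex' mulrDr scalerAr.
move=> [J [Z [i [j [cZ _ ->]]]]]; elim/lin_span_ind: y / (gen y) => [|a y y' ey ey'|y].
- by rewrite mulr0 linear0 mul0r.
- by rewrite mulrDr -scalerAr !linearP /= ey ey' mulrDl scalerAl.
by move=> [J' [Z' [i' [j' [cZ' _ ->]]]]]; apply: antipode_comatrixM.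
Qed.

Lemma cocommutative_gen :
  (forall i j, tflip (comul (Y i j)) = comul (Y i j)) -> cocommutative H.
Proof.
have [comul1 comulM] := @comul_monoid_morphism k H.
have tflipM (s t : tensor H H) : tflip (s * t) = tflip s * tflip t.
  elim/tens_ind: s => [|x y Hx Hy|a b]; first by rewrite !(mul0r, linear0).
    by rewrite mulrDl !linearD /= Hx Hy mulrDl.
  elim/tens_ind: t => [|x y Hx Hy|a' b']; first by rewrite !(mulr0, linear0).
    by rewrite mulrDr !linearD /= Hx Hy mulrDr.
  by rewrite tensM !tflipE tensM.
move=> Ycc; apply: (@inner_faithful_ind (fun h => tflip (comul h) = comul h)) => //.
- by rewrite !linear0.
- by move=> a x y ex ey; rewrite !linearP /= ex ey.
- by rewrite comul1 tflipE.
- by move=> x y ex ey; rewrite comulM tflipM ex ey.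
move=> J Z cZ Zcc i j; rewrite (antipode_comatrix cZ j i).1 linear_sum.
have := congr1 (tmap antipode antipode) (Zcc i j); rewrite (cZ i j).1 !linear_sum /=.
under eq_bigr do rewrite tflipE tmapE; under [X in _ = X]eq_bigr do rewrite tmapE.
by move=> e; under eq_bigr do rewrite tflipE.
Qed.

End InnerFaithful.

(** * The square of the antipode on the coefficients *)

Section ScalarMatrices.
Variables (k : fieldType) (H : algType k).

Definition emb m n (A : 'M[k]_(m, n)) : 'M[H]_(m, n) := map_mx (in_alg H) A.

Lemma embE m n (A : 'M[k]_(m, n)) i j : emb A i j = (A i j)%:A.
Proof. by rewrite mxE. Qed.

Lemma embM m n p (A : 'M[k]_(m, n)) (B : 'M[k]_(n, p)) :
  emb (A *m B) = emb A *m emb B.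
Proof. exact: map_mxM. Qed.

Lemma emb1 n : emb (1%:M : 'M[k]_n) = 1%:M.
Proof. exact: map_mx1. Qed.

Lemma embD m n (A B : 'M[k]_(m, n)) : emb (A + B) = emb A + emb B.
Proof. exact: map_mxD. Qed.

Lemma emb0 m n : emb (0 : 'M[k]_(m, n)) = 0.
Proof. exact: map_mx0. Qed.

Lemma mul_embE m n p (A : 'M[k]_(m, n)) (B : 'M[H]_(n, p)) i j :
  (emb A *m B) i j = \sum_l A i l *: B l j.
Proof. by rewrite mxE; apply: eq_bigr => l _; rewrite embE -scalerAl mul1r. Qed.

Lemma mulmx_embE m n p (B : 'M[H]_(m, n)) (A : 'M[k]_(n, p)) i j :
  (B *m emb A) i j = \sum_l A l j *: B i l.
Proof. by rewrite mxE; apply: eq_bigr => l _; rewrite embE -scalerAr mulr1. Qed.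

Lemma tr_emb_mul m n p (A : 'M[k]_(m, n)) (B : 'M[H]_(n, p)) :
  (emb A *m B)^T = B^T *m emb A^T.
Proof.
apply/matrixP => i j; rewrite mxE mul_embE mulmx_embE.
by apply: eq_bigr => l _; rewrite !mxE.
Qed.

Lemma tr_mul_emb m n p (B : 'M[H]_(m, n)) (A : 'M[k]_(n, p)) :
  (B *m emb A)^T = emb A^T *m B^T.
Proof. by rewrite -[in LHS](trmxK B) -[A in LHS]trmxK -tr_emb_mul trmxK. Qed.

Lemma mul_scalarE m n (B : 'M[H]_(m, n)) a i j : (B *m a%:M) i j = B i j * a.
Proof.
rewrite mxE (bigD1 j) //= big1 => [|l lj]; first by rewrite addr0 mxE eqxx.
by rewrite mxE (negbTE lj) mulr0n mulr0.
Qed.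

Lemma scalar_mulE m n (B : 'M[H]_(m, n)) a i j : (a%:M *m B) i j = a * B i j.
Proof. by rewrite mul_scalar_mx mxE. Qed.

Lemma scalar_embC n a (A : 'M[k]_n) : a%:M *m emb A = emb A *m a%:M.
Proof.
apply/matrixP=> i j; rewrite scalar_mulE mul_scalarE embE.
by rewrite -scalerAl -scalerAr mul1r mulr1.
Qed.

Lemma scalar_embAC m n (B : 'M[H]_(m, n)) a (A : 'M[k]_n) :
  B *m a%:M *m emb A = B *m emb A *m a%:M.
Proof. by rewrite -!mulmxA scalar_embC. Qed.

Lemma map_emb_mul (f : {linear H -> H}) m n p (A : 'M[k]_(m, n)) (B : 'M[H]_(n, p)) :
  map_mx f (emb A *m B) = emb A *m map_mx f B.
Proof.
apply/matrixP => i j; rewrite mxE !mul_embE linear_sum.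
by apply: eq_bigr => l _; rewrite linearZ mxE.
Qed.

Lemma map_mul_emb (f : {linear H -> H}) m n p (B : 'M[H]_(m, n)) (A : 'M[k]_(n, p)) :
  map_mx f (B *m emb A) = map_mx f B *m emb A.
Proof.
apply/matrixP => i j; rewrite mxE !mulmx_embE linear_sum.
by apply: eq_bigr => l _; rewrite linearZ mxE.
Qed.

End ScalarMatrices.

Section AntipodeOfCoefficients.
Variables (k : fieldType) (H : hopfAlgType k) (N : nat).
Variables (E : 'M[k]_N) (Y : 'M[H]_N) (D Dinv : H).
Hypothesis E_unit : E \in unitmx.
Hypothesis cY : comatrix (fun i j => Y i j).
Hypothesis antipode_anti : forall x y : H, antipode (x * y) = antipode y * antipode x.
Hypothesis Dgl : group_like D.
Hypothesis DDinv : D * Dinv = 1.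
Hypothesis DinvD : Dinv * D = 1.
Hypothesis YEY : Y *m emb H E *m Y^T = emb H E *m Dinv%:M.

Let S : {linear H -> H} := antipode.
Let M := E *m (invmx E)^T.
Let Minv := E^T *m invmx E.

Lemma group_like1 : group_like (1 : H).
Proof.
have [comul1 _] := @comul_monoid_morphism k H.
by have [counit1 _] := @counit_monoid_morphism k H.
Qed.

Lemma group_like_comatrix (g : H) : group_like g -> comatrix (fun _ _ : unit => g).
Proof.
move=> [g1 g2] [] []; rewrite g1 g2; split=> //.
by rewrite big_const card_unit /= addr0.
Qed.

Lemma antipode_group_like (g : H) : group_like g ->
  antipode g * g = 1 /\ g * antipode g = 1.
Proof.
move=> /group_like_comatrix cg; have := comatrix_antipodel tt tt cg.
have := comatrix_antipoder tt tt cg.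
by rewrite !big_const card_unit /= !addr0.
Qed.

Let SD : S D = Dinv.
Proof. by rewrite -[LHS]mulr1 -DDinv mulrA (antipode_group_like Dgl).1 mul1r. Qed.

Let S1 : S 1 = 1.
Proof.
by rewrite -[LHS]mulr1 (antipode_group_like group_like1).1.
Qed.

Let SDinv : S Dinv = D.
Proof.
have SS : S Dinv * Dinv = 1 by rewrite -{2}SD -antipode_anti DDinv; exact: S1.
by rewrite -[LHS]mulr1 -DinvD mulrA SS mul1r.
Qed.

Let cosquareK : M *m Minv = 1%:M.
Proof.
have Etu : E^T \in unitmx by rewrite unitmx_tr.
by rewrite /M /Minv trmx_inv mulmxA mulmxKV // mulmxV.
Qed.

Let DinvDM n : (Dinv%:M : 'M[H]_n) *m D%:M = 1%:M.
Proof.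
apply/matrixP=> i j; rewrite mul_scalarE !mxE.
by case: eqP; rewrite ?mulr1n ?mulr0n ?DinvD ?mul0r.
Qed.

(** [Y] has the right inverse [E Y^T E^-1 D], and the antipode gives a left inverse. *)
Lemma antipode_coeff :
  map_mx S Y = emb H E *m Y^T *m emb H (invmx E) *m D%:M.
Proof.
have SYY : map_mx S Y *m Y = 1%:M.
  apply/matrixP => i j; rewrite !mxE -(comatrix_antipodel _ _ cY).
  by apply: eq_bigr => l _; rewrite mxE.
have YX : Y *m (emb H E *m Y^T *m emb H (invmx E) *m D%:M) = 1%:M.
  rewrite !mulmxA YEY -(mulmxA (emb H E)) scalar_embC -!mulmxA DinvDM mulmx1.
  by rewrite -embM mulmxV ?emb1.
by rewrite -[LHS]mulmx1 -YX mulmxA SYY mul1mx.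
Qed.

(** The factor [D] moves to the left as [D^-1] since the antipode reverses products. *)
Lemma antipode2_coeff :
  map_mx S (map_mx S Y) = Dinv%:M *m (emb H M *m Y *m emb H Minv) *m D%:M.
Proof.
have S_mulD (B : 'M[H]_N) : map_mx S (B *m D%:M) = Dinv%:M *m map_mx S B.
  apply/matrixP => i j; rewrite mxE mul_scalarE [LHS]antipode_anti scalar_mulE mxE.
  by congr (_ * _); exact: SD.
have tr_mulD (B : 'M[H]_N) : (B *m D%:M)^T = B^T *m D%:M.
  by apply/matrixP => i j; rewrite mxE !mul_scalarE mxE.
rewrite {1}antipode_coeff S_mulD map_mul_emb map_emb_mul -map_trmx.
rewrite antipode_coeff tr_mulD tr_mul_emb tr_emb_mul trmxK.
by rewrite /M /Minv !embM !mulmxA scalar_embAC.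
Qed.

Lemma antipode_iter_coeff j :
  map_mx (iter j.*2 S) Y = (Dinv ^+ j)%:M *m
    (emb H (M ^+ j) *m Y *m emb H (Minv ^+ j)) *m (D ^+ j)%:M.
Proof.
have SS_conj i (B : 'M[H]_N) :
    map_mx S (map_mx S ((Dinv ^+ i)%:M *m B *m (D ^+ i)%:M)) =
    (Dinv ^+ i)%:M *m map_mx S (map_mx S B) *m (D ^+ i)%:M.
  have SX n : S (D ^+ n) = Dinv ^+ n /\ S (Dinv ^+ n) = D ^+ n.
    elim: n => [|n [IH1 IH2]]; first by rewrite !expr0 S1.
    split.
      by rewrite exprS [LHS]antipode_anti [antipode _]IH1 [antipode _]SD -exprSr.
    by rewrite exprS [LHS]antipode_anti [antipode _]IH2 [antipode _]SDinv -exprSr.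
  apply/matrixP => a b; rewrite mul_scalarE scalar_mulE mxE [in LHS]mxE.
  rewrite mul_scalarE scalar_mulE !mxE.
  have SM (x y z : H) : S (S (x * y * z)) = S (S x) * S (S y) * S (S z).
    by rewrite /S !antipode_anti.
  by rewrite [LHS]SM; congr (_ * _ * _); rewrite !((SX i).1, (SX i).2).
elim: j => [|j IH].
  by rewrite !expr0 emb1 mul1mx !mulmx1 mul1mx; apply/matrixP => a b; rewrite mxE.
have -> : map_mx (iter j.+1.*2 S) Y = map_mx S (map_mx S (map_mx (iter j.*2 S) Y)).
  by apply/matrixP => a b; rewrite !mxE.
rewrite IH SS_conj map_mul_emb map_emb_mul map_mul_emb map_emb_mul antipode2_coeff.
have scM (x y : H) : (x * y)%:M = (x%:M : 'M_N) *m y%:M.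
  by apply/matrixP => a b; rewrite scalar_mulE !mxE mulrnAr.
rewrite [Dinv ^+ j.+1]exprSr scM [D ^+ j.+1]exprS scM.
rewrite [M ^+ j.+1]exprSr [Minv ^+ j.+1]exprS.
rewrite -[_ * M]/(_ *m M) -[Minv * _]/(Minv *m _) !embM.
rewrite !mulmxA; congr (_ *m _).
by rewrite scalar_embAC -[in LHS](mulmxA _ (emb H _) Dinv%:M) -scalar_embC !mulmxA.
Qed.

Lemma coeff_cosquare_comm j :
  (forall h : H, iter j.*2 antipode h = h) -> central (D ^+ j) ->
  Y *m emb H (M ^+ j) = emb H (M ^+ j) *m Y.
Proof.
move=> Sj Dc; have : map_mx (iter j.*2 S) Y = Y.
  by apply/matrixP => a b; rewrite mxE Sj.
rewrite antipode_iter_coeff.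
have -> (B : 'M[H]_N) : (Dinv ^+ j)%:M *m B *m (D ^+ j)%:M = B.
  have DX : Dinv ^+ j * D ^+ j = 1.
    by rewrite -exprMn_comm ?DinvD ?expr1n // /GRing.comm DDinv.
  apply/matrixP => a b; rewrite mul_scalarE scalar_mulE -mulrA -[_ * _ ^+ _]Dc.
  by rewrite mulrA DX mul1r.
have MjK : Minv ^+ j *m M ^+ j = 1%:M.
  have MinvK : Minv *m M = 1%:M by apply: mulmx1C cosquareK.
  elim: j {Sj Dc} => [|j IH]; first by rewrite mulmx1.
  rewrite exprSr exprS -[_ * Minv]/(_ *m _) -[M * _]/(_ *m _).
  by rewrite mulmxA -(mulmxA _ Minv) MinvK mulmx1.
by move=> {1}<-; rewrite -!mulmxA -embM MjK emb1 mulmx1.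
Qed.

End AntipodeOfCoefficients.

(** * Comatrices commuting with a nonderogatory matrix *)

Section DividedSequences.
Variables (k : fieldType) (H : hopfAlgType k).

(** Sequences of divided powers: [\sum_(t <= m) y t *: X ^+ t] is group-like over
    [k[X] / (X ^+ m.+1)]. *)
Definition divided_sequence (m : nat) (y : nat -> H) : Prop :=
  forall t, (t <= m)%N ->
    comul (y t) = \sum_(l < t.+1) y l \ox y (t - l)%N /\
    counit (y t) = (t == 0%N)%:R.

(** [T = W Y R] is the matrix of the subcomodule spanned by the rows of [W]. *)
Lemma comatrix_semiconj N m (Y : 'M[H]_N) (T : 'M[H]_m) (W : 'M[k]_(m, N))
    (R : 'M[k]_(N, m)) :
  comatrix (fun i j => Y i j) -> emb H W *m Y = T *m emb H W -> W *m R = 1%:M ->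
  comatrix (fun i j => T i j).
Proof.
move=> cY WY WR; have TE : T = emb H W *m Y *m emb H R.
  by rewrite WY -mulmxA -embM WR emb1 mulmx1.
move=> i j; have TijE : T i j = \sum_b \sum_a (R b j * W i a) *: Y a b.
  rewrite TE mulmx_embE; apply: eq_bigr => b _; rewrite mul_embE scaler_sumr.
  by apply: eq_bigr => a _; rewrite scalerA.
split.
  transitivity (\sum_c (emb H W *m Y) i c \ox (Y *m emb H R) c j).
    rewrite TijE linear_sum.
    transitivity (\sum_b \sum_a \sum_c (W i a *: Y a c) \ox (R b j *: Y c b)).
      apply: eq_bigr => b _; rewrite linear_sum; apply: eq_bigr => a _.
      rewrite linearZ /= (cY a b).1 scaler_sumr; apply: eq_bigr => c _.
      by rewrite tensZl tensZr scalerA mulrC.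
    transitivity (\sum_b \sum_c (emb H W *m Y) i c \ox (R b j *: Y c b)).
      apply: eq_bigr => b _; rewrite exchange_big; apply: eq_bigr => c _.
      by rewrite -tens_suml -mul_embE.
    rewrite exchange_big; apply: eq_bigr => c _.
    by rewrite -tens_sumr -mulmx_embE.
  transitivity (\sum_c \sum_l (W l c *: T i l) \ox (Y *m emb H R) c j).
    by apply: eq_bigr => c _; rewrite WY mulmx_embE tens_suml.
  rewrite exchange_big; apply: eq_bigr => l _.
  transitivity (T i l \ox (emb H W *m (Y *m emb H R)) l j); last by rewrite mulmxA -TE.
  rewrite mul_embE tens_sumr; apply: eq_bigr => c _.
  by rewrite tensZl tensZr.
rewrite TijE linear_sum /=.
have <- : (W *m R) i j = (i == j)%:R by rewrite WR mxE.
rewrite mxE.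
transitivity (\sum_b \sum_a (R b j * W i a) * (a == b)%:R).
  apply: eq_bigr => b _; rewrite linear_sum; apply: eq_bigr => a _.
  by rewrite linearZ /= (cY a b).2.
apply: eq_bigr => b _; rewrite (bigD1 b) //= eqxx mulr1 big1 ?addr0 => [|a /negbTE ->].
  by rewrite mulrC.
by rewrite mulr0.
Qed.

(** The first row of the comatrix is the sequence itself. *)
Lemma toeplitz_divided_sequence m (y : nat -> H) :
  comatrix (fun i j : 'I_m.+1 => if (i <= j)%N then y (j - i)%N else 0) ->
  divided_sequence m y.
Proof.
move=> cT t; rewrite -ltnS => tm; have [] := cT ord0 (Ordinal tm).
rewrite subn0 -val_eqE /= eq_sym => -> ->; split=> //.
under eq_bigr do rewrite subn0.
rewrite (big_ord_widen m.+1 (fun l => y l \ox y (t - l)%N) tm) [RHS]big_mkcond /=.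
apply: eq_bigr => l _; rewrite ltnS; case: leqP => // _.
by rewrite -(scale0r (0 : H)) tensZr scale0r.
Qed.

End DividedSequences.

Section CommutingComatrix.
Variables (k : closedFieldType) (H : hopfAlgType k) (N : nat).
Variables (M : 'M[k]_N) (Y : 'M[H]_N).
Hypothesis M_nonderog : nonderogatory M.
Hypothesis cY : comatrix (fun i j => Y i j).
Hypothesis YM : Y *m emb H M = emb H M *m Y.

(** The row [v Y] is annihilated by [A ^+ m.+1], where [A = M - z].  The identity
    [1 = A ^+ m.+1 X + Z W], whose rows [W] form the chain of [v], turns this into
    an expansion [v Y = \sum_t y_t v A ^+ t] over [H].  Multiplying by powers of
    [A] shifts the chain, so [Y] acts on it by the Toeplitz matrix of [y]. *)
Lemma commuting_row (z : k) m (v : 'rV[k]_N) :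
  v *m (M - z%:M) ^+ m.+1 = 0 -> v *m (M - z%:M) ^+ m != 0 ->
  exists2 y, divided_sequence m y &
    emb H v *m Y = \row_j \sum_(t < m.+1) (v *m (M - z%:M) ^+ t) 0 j *: y t.
Proof.
set A := M - z%:M => vA0 vA; have Ar : (N <= (\rank A).+1)%N by exact: M_nonderog.
have /row_freeP[R WR] := chain_row_free vA0 vA.
have kerW := ker_sub_chain Ar vA0 vA; set W := chain A v m.+1 in WR kerW.
have YA : Y *m emb H A = emb H A *m Y.
  rewrite /A -[- z%:M]raddfN /= !embD mulmxDr mulmxDl YM; congr (_ + _).
  apply/matrixP => i j; rewrite mul_embE mulmx_embE (bigD1 j) // [RHS](bigD1 i) //=.
  rewrite !big1 ?addr0 ?mxE ?eqxx // => l li; rewrite mxE ?(negbTE li) ?scale0r //.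
  by rewrite eq_sym (negbTE li) scale0r.
have YAn n : Y *m emb H (A ^+ n) = emb H (A ^+ n) *m Y.
  elim: n => [|n IH]; first by rewrite expr0 emb1 mulmx1 mul1mx.
  by rewrite exprS -[A * _]/(A *m _) embM mulmxA YA -!mulmxA IH.
have : (1%:M - A ^+ m.+1 *m pinvmx (A ^+ m.+1) <= kermx (A ^+ m.+1)%R)%MS.
  by apply/sub_kermxP; rewrite mulmxBl mul1mx mulmxKpV ?subrr.
move=> /submx_trans/(_ kerW)/submxP[Z IZ].
pose y0 := emb H v *m Y *m emb H Z.
have vY : emb H v *m Y = y0 *m emb H W.
  have I1 : (1%:M : 'M[k]_N) = A ^+ m.+1 *m pinvmx (A ^+ m.+1) + Z *m W.
    by rewrite -IZ addrC subrK.
  rewrite -[LHS]mulmx1 -(emb1 H) I1 embD !embM mulmxDr !mulmxA -(mulmxA (emb H v)) YAn.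
  by rewrite mulmxA -(embM _ v) vA0 emb0 !mul0mx add0r.
pose y (t : nat) : H := if insub t is Some j then y0 0 j else 0.
have yE (t : 'I_m.+1) : y t = y0 0 t by rewrite /y valK.
have vA_ge t : (m < t)%N -> v *m A ^+ t = 0.
  by move=> mt; rewrite -(subnKC mt) exprD -[_ * _]/(_ *m _) mulmxA vA0 mul0mx.
have vYE i j : (emb H v *m emb H (A ^+ i) *m Y) 0 j =
    \sum_(0 <= t < m.+1) (v *m A ^+ (t + i)) 0 j *: y t.
  rewrite -mulmxA -YAn mulmxA vY -mulmxA -embM mulmx_embE big_mkord.
  apply: eq_bigr => t _; rewrite yE; congr (_ *: _).
  have -> : (W *m A ^+ i) t j = (row t (W *m A ^+ i)) 0 j by rewrite [RHS]mxE.
  by rewrite row_mul rowK -mulmxA -[A ^+ t *m _]/(_ * _) -exprD.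
exists y; last first.
  apply/rowP => j; have := vYE 0%N j; rewrite expr0 emb1 mulmx1 => ->.
  by rewrite mxE big_mkord; apply: eq_bigr => t _; rewrite addn0.
pose T : 'M[H]_m.+1 := \matrix_(i, j) if (i <= j)%N then y (j - i)%N else 0.
apply: toeplitz_divided_sequence.
have -> : (fun i j : 'I_m.+1 => if (i <= j)%N then y (j - i)%N else 0) =
          (fun i j => T i j).
  by apply/funext => i; apply/funext => j; rewrite mxE.
apply: comatrix_semiconj cY _ WR; apply/matrixP => i j.
have -> : (emb H W *m Y) i j = (emb H v *m emb H (A ^+ i) *m Y) 0 j.
  by rewrite -embM !mul_embE; apply: eq_bigr => l _; rewrite mxE.
rewrite vYE mulmx_embE.
transitivity (\sum_(0 <= l < m.+1) (v *m A ^+ l) 0 j *: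
    (if (i <= l)%N then y (l - i)%N else 0)); last first.
  by rewrite big_mkord; apply: eq_bigr => l _; rewrite !mxE.
have im : (i <= m.+1)%N by rewrite ltnW.
rewrite [RHS](big_cat_nat (leq0n i) im) /= [X in _ = X + _]big_nat.
rewrite [X in _ = X + _]big1 => [|l /andP[_ li]]; last by rewrite leqNgt li scaler0.
rewrite add0r -{2}[nat_of_ord i]add0n big_addn.
rewrite [LHS](big_cat_nat (leq0n (m.+1 - i)) (leq_subr _ _)) /= [X in _ + X]big_nat.
rewrite [X in _ + X]big1 => [|l /andP[ml _]]; last first.
  by rewrite vA_ge ?mxE ?scale0r // addnC -ltnS ltnS -leq_subLR.
by rewrite addr0; apply: eq_bigr => l _; rewrite leq_addl addnK.
Qed.

Lemma coeff_in_submodule (P : set H) : P 0 ->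
  (forall a x y, P x -> P y -> P (a *: x + y)) ->
  (forall m y t, divided_sequence m y -> (t <= m)%N -> P (y t)) ->
  forall i j, P (Y i j).
Proof.
move=> P0 Plin Pdiv i j.
have PD x y : P x -> P y -> P (x + y).
  by move=> Px Py; rewrite -[x]scale1r; apply: Plin.
have PZ a x : P x -> P (a *: x) by move=> Px; rewrite -[_ *: _]addr0; apply: Plin.
pose Q (v : 'rV[k]_N) := forall j, P ((emb H v *m Y) 0 j).
suff /(_ (delta_mx 0 i) j) : forall v, Q v.
  rewrite mul_embE (bigD1 i) //= mxE !eqxx scale1r big1 ?addr0 // => l /negbTE li.
  by rewrite mxE li andbF scale0r.
apply: (primary_ind (M := M)) => [l|v w Qv Qw l|z m v vA0].
- by rewrite emb0 mul0mx mxE.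
- by rewrite embD mulmxDl mxE; apply: PD.
have [->|v0] := eqVneq v 0; first by move=> l; rewrite emb0 mul0mx mxE.
have ex : exists n, v *m (M - z%:M) ^+ n == 0 by exists m; apply/eqP.
case: (ex_minnP ex) => -[|n] /eqP vn0 min_n.
  by rewrite mulmx1 in vn0; rewrite vn0 eqxx in v0.
have vn : v *m (M - z%:M) ^+ n != 0 by apply/negP => /min_n; rewrite ltnn.
have [y dy vY] := commuting_row vn0 vn.
move=> l; rewrite vY mxE; elim/big_ind: _ => // t _.
by apply: PZ; apply: Pdiv dy _; rewrite -ltnS.
Qed.

(** The comultiplication of a divided sequence is invariant under [l |-> t - l]. *)
Lemma coeff_cocommutative i j : tflip (comul (Y i j)) = comul (Y i j).
Proof.
apply: (@coeff_in_submodule (fun h => tflip (comul h) = comul h)) => //.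
- by rewrite !linear0.
- by move=> a x y ex ey; rewrite !linearP /= ex ey.
move=> m y t dy tm; rewrite (dy t tm).1 linear_sum.
rewrite [RHS](reindex_inj rev_ord_inj); apply: eq_bigr => l _ /=.
by rewrite tflipE subSS subKn // -ltnS.
Qed.

End CommutingComatrix.

(** * Linear independence in finite dimension *)

Section FiniteDimensional.
Variables (k : fieldType) (V : lmodType k).

(** Families are indexed by [nat] so that they can be extended one term at a time. *)
Definition lin_indep (d : nat) (x : nat -> V) : Prop :=
  forall a : nat -> k, \sum_(i < d) a i *: x i = 0 -> forall i, (i < d)%N -> a i = 0.

Lemma lin_indep_extend d x : lin_indep d x -> ~ lin_indep d.+1 x ->
  exists c : nat -> k, x d = \sum_(i < d) c i *: x i.
Proof.
move=> xd nxd; apply: contrapT => nc; apply: nxd => a; rewrite big_ord_recr /= => a0.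
have ad : a d = 0.
  apply: contrapT => /eqP ad; apply: nc; exists (fun i => - (a d)^-1 * a i).
  apply: (scalerI ad); rewrite scaler_sumr; apply/eqP.
  under eq_bigr do rewrite scalerA mulrA mulrN divff // mulN1r scaleNr.
  by rewrite sumrN -addr_eq0 addrC a0.
move=> i; rewrite ltnS leq_eqVlt => /orP[/eqP -> //|].
by apply: xd; move: a0; rewrite ad scale0r addr0.
Qed.

Hypothesis V_fd : finite_dimensional V.

(** A spanning family of minimal size is a basis. *)
Lemma fd_coordinates : exists n (c : {linear V -> 'rV[k]_n}), injective c.
Proof.
pose spans n := `[< exists b : 'I_n -> V, forall v, exists a : 'I_n -> k,
    v = \sum_i a i *: b i >].
have ex : exists n, spans n by have [n bP] := V_fd; exists n; apply/asboolP.
case: (ex_minnP ex) => n /asboolP[b b_span] n_min.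
have [c cP] := choice b_span.
have b_free (a : 'I_n -> k) : \sum_i a i *: b i = 0 -> forall i, a i = 0.
  move=> a0 i; apply: contrapT => /eqP ai.
  case: n i {ex} b b_span n_min c cP a a0 ai => [[]//|n] i b b_span n_min c cP a a0 ai.
  suff /n_min : spans n by rewrite ltnn.
  apply/asboolP; exists (fun j => b (lift i j)) => v.
  exists (fun j => c v (lift i j) - c v i * (a i)^-1 * a (lift i j)).
  have bi : b i = - \sum_j ((a i)^-1 * a (lift i j)) *: b (lift i j).
    apply: (scalerI ai); apply/eqP; rewrite scalerN -addr_eq0.
    rewrite scaler_sumr; under eq_bigr do rewrite scalerA mulrA divff // mul1r.
    by move/eqP: a0; rewrite (bigD1_ord i).
  rewrite {1}[v]cP (bigD1_ord i) //= {1}bi scalerN scaler_sumr -sumrN -big_split.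
  apply: eq_bigr => j _ /=; rewrite scalerBl !scalerA addrC; congr (_ - _ *: _).
  by rewrite mulrA.
pose f (v : V) : 'rV[k]_n := \row_i c v i.
have f_lin : linear f.
  move=> a u v; apply/rowP => i; rewrite !mxE; apply/eqP; rewrite -subr_eq0; apply/eqP.
  apply: (b_free (fun i => c (a *: u + v) i - (a * c u i + c v i))).
  under eq_bigr do rewrite scalerBl scalerDl -scalerA.
  by rewrite sumrB big_split /= -scaler_sumr -!cP subrr.
pose F : {linear V -> 'rV[k]_n} :=
  HB.pack f (GRing.isLinear.Build k V 'rV[k]_n *:%R f f_lin).
exists n, F => u v e.
rewrite [u]cP [v]cP; apply: eq_bigr => i _; congr (_ *: _).
by have /rowP/(_ i) := e; rewrite !mxE.
Qed.

Lemma lin_indep_row_free n (c : {linear V -> 'rV[k]_n}) d x :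
  injective c -> lin_indep d x -> row_free (\matrix_(i < d) c (x i)).
Proof.
move=> c_inj xd; set X := \matrix_(_ < _) _.
rewrite -kermx_eq0; apply/eqP/row_matrixP => r; rewrite row0.
have : row r (kermx X) *m X = 0 by apply/sub_kermxP/row_sub.
move: (row r _) => a; rewrite mulmx_sum_row => a0.
pose a' i := if insub i is Some j then a 0 j else 0.
have a'E (i : 'I_d) : a' i = a 0 i by rewrite /a' valK.
apply/rowP => i; rewrite mxE -a'E; apply: xd (ltn_ord i); apply: c_inj.
rewrite linear_sum linear0 -[RHS]a0; apply: eq_bigr => j _.
by rewrite linearZ rowK a'E.
Qed.

Lemma lin_indep_bound : exists n, forall d x, lin_indep d x -> (d <= n)%N.
Proof.
have [n [c c_inj]] := fd_coordinates; exists n => d x xd.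
by rewrite -(eqP (lin_indep_row_free c_inj xd)); apply: rank_leq_col.
Qed.

Lemma lin_indep_dual d x : lin_indep d x ->
  exists phi : 'I_d -> {scalar V}, forall (i : 'I_d) j, (j < d)%N ->
    phi i (x j) = (i == j :> nat)%:R.
Proof.
have [n [c c_inj]] := fd_coordinates => xd.
have := lin_indep_row_free c_inj xd; set X := \matrix_(_ < _) _.
move=> /row_freeP[R XR].
pose f (i : 'I_d) (v : V) : k := (c v *m R) 0 i.
have f_lin i : scalar (f i).
  by move=> a u v; rewrite /f linearP mulmxDl -scalemxAl !mxE.
pose F i : {scalar V} := HB.pack (f i) (GRing.isLinear.Build k V k *%R (f i) (f_lin i)).
exists F => i j lt_j; rewrite -[F i _]/(f i (x j)) /f.
have -> : c (x j) = row (Ordinal lt_j) X by rewrite rowK.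
by rewrite -row_mul XR !mxE eq_sym.
Qed.

End FiniteDimensional.

(** * Group-like and primitive elements *)

Section GroupLike.
Variables (k : fieldType) (H : hopfAlgType k).

Lemma group_likeM (g h : H) : group_like g -> group_like h -> group_like (g * h).
Proof.
have [_ cM] := @comul_monoid_morphism k H; have [_ eM] := @counit_monoid_morphism k H.
by move=> [g1 g2] [h1 h2]; split; rewrite ?cM ?eM ?g1 ?g2 ?h1 ?h2 ?tensM ?mulr1.
Qed.

Lemma group_like_antipode (g : H) : group_like g -> group_like (antipode g).
Proof.
move=> /group_like_comatrix/antipode_comatrix/(_ tt tt) [c e]; split; last first.
  by rewrite e eqxx.
by rewrite c big_const card_unit /= addr0.
Qed.

Lemma group_like_spanM (x y : H) : x \in lin_span (@group_like k H) ->
  y \in lin_span (@group_like k H) -> x * y \in lin_span (@group_like k H).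
Proof.
move=> Gx; elim/lin_span_ind: y / => [|a y y' Gy Gy'|h gl_h].
- by rewrite mulr0 rpred0.
- by rewrite mulrDr -scalerAr rpredD // rpredZ.
elim/lin_span_ind: x / Gx => [|a x x' Gx Gx'|g gl_g].
- by rewrite mul0r rpred0.
- by rewrite mulrDl -scalerAl rpredD // rpredZ.
exact/lin_span_gen/group_likeM.
Qed.

Lemma group_like_span_antipode (x : H) : x \in lin_span (@group_like k H) ->
  antipode x \in lin_span (@group_like k H).
Proof.
elim/lin_span_ind: x / => [|a x y Gx Gy|g gl_g].
- by rewrite linear0 rpred0.
- by rewrite linearP rpredD // rpredZ.
exact/lin_span_gen/group_like_antipode.
Qed.

Lemma group_like_neq0 (g : H) : group_like g -> g != 0.
Proof.
move=> [_ g1]; apply/eqP => g0; move: g1; rewrite g0 linear0 => /eqP.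
by rewrite eq_sym oner_eq0.
Qed.

Hypothesis H_fd : finite_dimensional H.

(** If [g = \sum_j c_j g_j] with the [g_j] independent, contracting
    [Delta g = g (x) g = \sum_j c_j g_j (x) g_j] by the [i]-th dual functional gives
    [c_i g = c_i g_i], so all [c_i] vanish when [g] is not among the [g_i]. *)
Lemma group_like_lin_indep (s : seq H) : uniq s -> (forall g, g \in s -> group_like g) ->
  lin_indep (size s) (nth 0 s).
Proof.
move=> s_uniq sgl; suff indep d : (d <= size s)%N -> lin_indep d (nth 0 s) by exact: indep.
elim: d => [|d IH] ds; first by move=> a _ [].
have {}IH := IH (ltnW ds); apply: contrapT => /(lin_indep_extend IH)[c gE].
set g := nth 0 s d in gE; have gl_g : group_like g by apply/sgl/mem_nth.
have [phi phiE] := lin_indep_dual H_fd IH.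
suff c0 : forall i : 'I_d, c i = 0.
  have := group_like_neq0 gl_g; rewrite gE big1 ?eqxx // => i _.
  by rewrite c0 scale0r.
have comul_g : comul g = \sum_(j < d) nth 0 s j \ox (c j *: nth 0 s j).
  rewrite gE linear_sum; apply: eq_bigr => j _; rewrite linearZ /= tensZr.
  by rewrite (sgl _ (mem_nth _ _)).1 //; apply: ltn_trans ds.
have phi_g (i : 'I_d) : phi i g = c i.
  rewrite gE linear_sum (bigD1 i) //= linearZ /= phiE // eqxx mulr1 big1 ?addr0 // => j ji.
  by rewrite linearZ /= phiE // eq_sym -val_eqE /= in ji *; rewrite (negbTE ji) mulr0.
move=> i; apply/eqP; apply: contraT => ci.
have : c i *: g = c i *: nth 0 s i.
  have := congr1 (tcoef (phi i)) gl_g.1; rewrite tcoefE /= phi_g => <-.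
  rewrite comul_g linear_sum (bigD1 i) //= tcoefE /= phiE // eqxx scale1r.
  rewrite big1 ?addr0 // => j ji; rewrite tcoefE /= phiE //.
  by rewrite eq_sym val_eqE (negbTE ji) scale0r.
move/(scalerI ci)/eqP; rewrite /g nth_uniq // ?gtn_eqF //.
exact: ltn_trans ds.
Qed.

Hypothesis k_char0 : [pchar k] =i pred0.

Lemma natr_neq0 n : (0 < n)%N -> (n%:R : k) != 0.
Proof. by rewrite lt0n; have /GRing.pcharf0P -> := k_char0. Qed.

(** Let [x ^+ d] be the first power depending linearly on the previous ones.  For
    [d >= 2] the coefficient of [x (x) x ^+ (d - 1)] in [Delta (x ^+ d)] is [d],
    while it vanishes in [Delta (x ^+ i)] for [i < d]: this contradicts
    characteristic zero.  For [d = 1] the counit shows that [x = 0]. *)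
Lemma primitive_eq0 (x : H) : comul x = 1 \ox x + x \ox 1 -> x = 0.
Proof.
have [comul1 comulM] := @comul_monoid_morphism k H.
move=> dx; have ex : counit x = 0.
  have [_ counitM] := @counit_monoid_morphism k H.
  have cx : tcoef counit (comul x) = x := counitl x.
  have := cx; rewrite dx linearD /= !tcoefE.
  rewrite (group_like1 H).2 scale1r => /eqP.
  rewrite eq_sym addrC -subr_eq subrr eq_sym => /eqP.
  by move/(congr1 counit); rewrite linearZ /= (group_like1 H).2 mulr1 linear0.
pose indep d := `[< lin_indep d (fun i => x ^+ i) >].
have ex_dep : exists d, ~~ indep d.+1.
  have [n n_max] := lin_indep_bound H_fd.
  by exists n; apply/negP => /asboolP/n_max; rewrite ltnn.
case: (ex_minnP ex_dep) => d /negP d_dep d_min.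
have d_ind : lin_indep d (fun i => x ^+ i).
  case: d d_dep d_min => [|d] _ d_min; first by move=> a _ [].
  by apply/asboolP/negPn/negP => /d_min; rewrite ltnn.
have [|c xdE] := lin_indep_extend d_ind.
  by move=> /asboolP.
have [phi phiE] := lin_indep_dual H_fd d_ind.
case: d d_ind d_dep d_min xdE phi phiE => [|[|d]] d_ind d_dep d_min xdE phi phiE.
- by move: xdE; rewrite big_ord0 expr0 => /eqP; rewrite oner_eq0.
- move: xdE; rewrite big_ord1 expr1 expr0 => xE; move: ex; rewrite xE linearZ /=.
  by rewrite (group_like1 H).2 mulr1 => ->; rewrite scale0r.
(* The coefficient of [x (x) x ^+ d.+1]. *)
pose psi (t : tensor H H) : k := phi ord_max (tcoef (phi (inord 1)) t).
have psi_lin : scalar psi by move=> a s t; rewrite /psi !linearP.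
pose Psi : {scalar tensor H H} :=
  HB.pack psi (GRing.isLinear.Build k (tensor H H) k *%R psi psi_lin).
have v1 : (inord 1 : 'I_d.+2) = 1%N :> nat by rewrite inordK.
have PsiE a b : (a + b <= d.+2)%N ->
    Psi (x ^+ a \ox x ^+ b) = ((a == 1%N) && (b == d.+1))%:R.
  move=> ab; rewrite -[Psi _]/(psi _) /psi tcoefE linearZ /=.
  (* An exponent [d.+2] on one side leaves [1] on the other, where it is killed. *)
  case: (ltnP a d.+2) => [lta|gea].
    case: (ltnP b d.+2) => [ltb|geb].
      by rewrite !phiE // v1 [a == _]eq_sym [b == _]eq_sym -natrM mulnb.
    have -> : a = 0%N by lia.
    by rewrite phiE // v1 mul0r.
  have -> : b = 0%N by lia.
  by rewrite [phi ord_max _]phiE // mulr0 andbF.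
have comulX i : comul (x ^+ i) = \sum_(l < i.+1) (x ^+ (i - l) \ox x ^+ l) *+ 'C(i, l).
  have tX (a b : H) n : (a \ox b) ^+ n = a ^+ n \ox b ^+ n.
    by elim: n => [|n IH]; rewrite ?expr0 // !exprS IH tensM.
  have -> : comul (x ^+ i) = (x \ox 1 + 1 \ox x) ^+ i.
    elim: i => [|i IH]; first by rewrite !expr0 comul1.
    by rewrite !exprS comulM IH dx addrC.
  rewrite exprDn_comm; last by rewrite /GRing.comm !tensM !mulr1 !mul1r.
  by apply: eq_bigr => l _; rewrite !tX !expr1n tensM mulr1 mul1r.
have Psi_comulX i : (i <= d.+2)%N ->
    Psi (comul (x ^+ i)) = if i == d.+2 then d.+2%:R else 0.
  move=> id2; rewrite comulX linear_sum /=.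
  rewrite (eq_bigr (fun l : 'I_i.+1 => if l == d.+1 :> nat then
     (if i == d.+2 then d.+2%:R else 0) else 0)) => [|l _].
    rewrite -big_mkcond (big_ord1_eq +%R (fun=> if i == d.+2 then d.+2%:R else 0)).
    by case: (i =P d.+2) => [->|]; rewrite ?leqnSn // if_same.
  rewrite -[psi _]/(Psi _) raddfMn -[X in X *+ _]/(Psi _) PsiE; last first.
    by have := ltn_ord l; lia.
  case: (nat_of_ord l =P d.+1) => [->|]; last by rewrite andbF mul0rn.
  rewrite andbT; case: (i =P d.+2) => [->|ne]; last first.
    have -> : (i - d.+1 == 1)%N = false by lia.
    by rewrite mul0rn.
  by rewrite subSnn eqxx binSn.
have := Psi_comulX _ (leqnn d.+2); rewrite eqxx {1}xdE linear_sum linear_sum.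
rewrite big1 => [/esym/eqP|i _].
  by rewrite (negbTE (natr_neq0 _)).
rewrite linearZ linearZ /= -[psi _]/(Psi _) Psi_comulX; last exact: ltnW.
by rewrite ltn_eqF ?mulr0.
Qed.

Lemma skew_primitive_eq0 (g y : H) : group_like g ->
  comul y = g \ox y + y \ox g -> y = 0.
Proof.
move=> gl_g dy; have [_ comulM] := @comul_monoid_morphism k H.
have [gl_Sg [Sgg gSg]] := (group_like_antipode gl_g, antipode_group_like gl_g).
suff x0 : antipode g * y = 0 by rewrite -[y]mul1r -gSg -mulrA x0 mulr0.
by apply: primitive_eq0; rewrite comulM gl_Sg.1 dy mulrDr !tensM Sgg.
Qed.

Lemma divided_sequence_trivial m (y : nat -> H) : divided_sequence m y ->
  group_like (y 0%N) /\ forall t, (0 < t <= m)%N -> y t = 0.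
Proof.
move=> dy; have gl0 : group_like (y 0%N).
  by have [] := dy 0%N (leq0n m); rewrite big_ord1 /= => d0 e0; split; rewrite ?d0 ?e0.
split=> // t; have [n le_n] := ubnP t; elim: n t le_n => // n IH [|t] // le_n /= tm.
apply: (skew_primitive_eq0 gl0); rewrite (dy t.+1 tm).1.
rewrite big_ord_recl big_ord_recr /= subn0 subnn big1 ?add0r // => l _.
have lt := ltn_ord l; rewrite [bump 0 l]add1n IH; try lia.
by rewrite -(scale0r (0 : H)) tensZl scale0r.
Qed.

End GroupLike.

(** * The group algebra of the group-like elements *)

Section GroupOfGroupLikes.
Variables (k : fieldType) (H : hopfAlgType k).
Variables (s : seq H) (sP : forall g, g \in s <-> group_like g).

(** The group of group-like elements, enumerated by [s].  The proof is an argument of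
    the type because the group structure attached to it is built from that proof. *)
Definition gl_group (_ : forall g, g \in s <-> group_like g) : Type := seq_sub s.
Local Notation G := (gl_group sP).
HB.instance Definition _ := Finite.on G.

Definition gl_mk (g : H) (gl_g : group_like g) : G := SeqSub ((sP g).2 gl_g).
Definition gl_val (x : G) : H := ssval x.

Lemma gl_valP (x : G) : group_like (gl_val x).
Proof. exact/sP/(valP (x : seq_sub s)). Qed.

Lemma gl_val_inj : injective gl_val.
Proof. exact: val_inj. Qed.

Definition gl_mul (x y : G) : G := gl_mk (group_likeM (gl_valP x) (gl_valP y)).
Definition gl_one : G := gl_mk (group_like1 H).
Definition gl_inv (x : G) : G := gl_mk (group_like_antipode (gl_valP x)).

Lemma gl_mulA : associative gl_mul.
Proof. by move=> x y z; apply: gl_val_inj; apply: mulrA. Qed.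

Lemma gl_mul1 : left_id gl_one gl_mul.
Proof. by move=> x; apply: gl_val_inj; apply: mul1r. Qed.

Lemma gl_mulV : left_inverse gl_one gl_inv gl_mul.
Proof. by move=> x; apply: gl_val_inj; apply: (antipode_group_like (gl_valP x)).1. Qed.

HB.instance Definition _ := Finite_isGroup.Build G gl_mulA gl_mul1 gl_mulV.

Hypothesis s_uniq : uniq s.
Hypothesis s_indep : lin_indep (size s) (nth 0 s).
Hypothesis s_span : forall h : H, h \in lin_span (@group_like k H).

Local Notation kG := (group_alg k G).

Definition gl_eval (f : kG) : H := \sum_(x : G) (f x : k) *: gl_val x.

Lemma gl_eval_is_linear : linear gl_eval.
Proof.
move=> a f h; rewrite /gl_eval scaler_sumr -big_split; apply: eq_bigr => x _ /=.
by rewrite !ffunE scalerDl scalerA.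
Qed.
HB.instance Definition _ := GRing.isLinear.Build k kG H *:%R gl_eval gl_eval_is_linear.

Lemma gl_eval_basis (x : G) : gl_eval (gbasis k x) = gl_val x.
Proof.
rewrite /gl_eval (bigD1 x) //= ffunE eqxx scale1r big1 ?addr0 // => y /negbTE yx.
by rewrite ffunE yx scale0r.
Qed.

Lemma gl_eval_inj : injective gl_eval.
Proof.
apply: raddf_inj => f f0; apply/ffunP => x; rewrite [RHS]ffunE.
pose c (g : H) : k := if insub g is Some y then f (y : G) else 0.
have cE (y : G) : c (gl_val y) = f y by rewrite /c (valK (y : seq_sub s)).
have xs (y : G) : gl_val y \in s by exact: (valP (y : seq_sub s)).
have vals_s : perm_eq [seq gl_val y | y <- enum {: G}] s.
  apply: uniq_perm => //; first by rewrite map_inj_uniq ?enum_uniq //; exact: gl_val_inj.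
  move=> g; apply/mapP/idP => [[y _ ->] //|gs].
  by exists (gl_mk ((sP g).1 gs)); rewrite ?mem_enum.
rewrite -cE -(nth_index 0 (xs x)).
apply: (s_indep (a := fun i => c (nth 0 s i))); last by rewrite index_mem.
rewrite -[RHS]f0 /gl_eval -(big_mkord xpredT (fun i => c (nth 0 s i) *: nth 0 s i)).
rewrite -(big_nth 0 xpredT (fun g : H => c g *: g)) -(perm_big _ vals_s) big_map /=.
by rewrite big_enum; apply: eq_bigr => y _; rewrite cE.
Qed.

Lemma gl_eval_surj h : exists f, gl_eval f = h.
Proof.
elim/lin_span_ind: h / (s_span h) => [|a x y [f <-] [g <-]|g gl_g].
- by exists 0; rewrite linear0.
- by exists (a *: f + g); rewrite linearP.
by exists (gbasis k (gl_mk gl_g)); rewrite gl_eval_basis.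
Qed.

Lemma gl_eval_mm : monoid_morphism gl_eval.
Proof.
split; first by rewrite -gbasis1 gl_eval_basis.
elim/galg_ind => [|a x y Hx Hy|g] h; first by rewrite !(mul0r, linear0).
  by rewrite mulrDl -scalerAl !linearP /= Hx Hy mulrDl -scalerAl.
elim/galg_ind: h => [|a x y Hx Hy|h]; first by rewrite !(mulr0, linear0).
  by rewrite mulrDr -scalerAr !linearP /= Hx Hy mulrDr -scalerAr.
by rewrite gbasisM !gl_eval_basis.
Qed.

Lemma gl_group_algebra : is_group_algebra H.
Proof.
have [f fK] := choice gl_eval_surj; have Kf x : f (gl_eval x) = x.
  exact/gl_eval_inj/fK.
have f_lin : linear f.
  by move=> a x y; apply: gl_eval_inj; rewrite linearP /= !fK.
pose F : {linear H -> kG} := HB.pack f (GRing.isLinear.Build k H kG *:%R f f_lin).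
exists G, F; have [e1 eM] := gl_eval_mm; split.
- by exists gl_eval.
- split; first by apply: gl_eval_inj; rewrite [gl_eval _]fK e1.
  by move=> x y; apply: gl_eval_inj; rewrite eM ![gl_eval (F _)]fK.
- move=> h; rewrite -[h]fK -[F (gl_eval _)]/(f (gl_eval _)) Kf.
  elim/galg_ind: (f h) => [|a x y Hx Hy|g]; first by rewrite !linear0.
    by rewrite !linearP /= Hx Hy.
  rewrite [LHS]galg_comulE gl_eval_basis (gl_valP g).1 tmapE.
  by rewrite -gl_eval_basis -[F (gl_eval _)]/(f (gl_eval _)) Kf.
- move=> h; rewrite -[h in RHS]fK -[F h]/(f h).
  elim/galg_ind: (f h) => [|a x y Hx Hy|g]; first by rewrite !linear0.
    by rewrite !linearP /= Hx Hy.
  by rewrite [LHS]galg_counitE gl_eval_basis (gl_valP g).2.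
Qed.

End GroupOfGroupLikes.

(** Linear independence bounds the number of group-like elements, so they can be
    listed. *)
Lemma group_like_span_group_algebra (k : fieldType) (H : hopfAlgType k) :
  finite_dimensional H -> (forall h : H, h \in lin_span (@group_like k H)) ->
  is_group_algebra H.
Proof.
move=> H_fd H_span.
pose gl_seq (s : seq H) := uniq s /\ forall g, g \in s -> group_like g.
have indep s : gl_seq s -> lin_indep (size s) (nth 0 s).
  by move=> [s_uniq s_gl]; apply: group_like_lin_indep.
pose has_gl n := `[< exists2 s, gl_seq s & size s = n >].
have ex : exists n, has_gl n by exists 0%N; apply/asboolP; exists [::].
have [n n_max] := lin_indep_bound H_fd.
have gl_le m : has_gl m -> (m <= n)%N.
  by move=> /asboolP[s /indep s_indep <-]; apply: n_max s_indep.
case: (ex_maxnP ex gl_le) => m /asboolP[s sgl sm] m_max.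
have sP g : g \in s <-> group_like g.
  split=> [/sgl.2 //|gl_g]; apply: contraT => gs.
  suff /m_max : has_gl m.+1 by rewrite ltnn.
  apply/asboolP; exists (g :: s); last by rewrite /= sm.
  split=> [|h]; first by rewrite /= gs sgl.1.
  by rewrite inE => /orP[/eqP ->|/sgl.2].
exact: (gl_group_algebra sP sgl.1 (indep s sgl) H_span).
Qed.

(** * Graded coactions on the free algebra *)

Section FreeCoeff.
Variables (k : fieldType) (N : nat).
Local Notation F := (free_alg k N).

Definition fcoeff (m : {fmonom 'I_N}) (x : F) : k :=
  (x : {malg k[{fmonom 'I_N}]})@_m.

Lemma fcoeff_is_scalar m : scalar (fcoeff m).
Proof. by move=> a x y; rewrite /fcoeff [LHS]mcoeffD mcoeffZ. Qed.
HB.instance Definition _ m := GRing.isLinear.Build k F k *%R (fcoeff m) (fcoeff_is_scalar m).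

Lemma fcoeff_eq (x y : F) : (forall m, fcoeff m x = fcoeff m y) -> x = y.
Proof. by move=> e; apply/malgP => m; apply: e. Qed.

Lemma fcoeff_var m i : fcoeff m (fvar k i) = (fmu i == m)%:R.
Proof. by rewrite /fcoeff /fvar mcoeffU. Qed.

Lemma fmonom_eq (m1 m2 : {fmonom 'I_N}) : (m1 == m2) = (m1 == m2 :> seq 'I_N).
Proof. by []. Qed.

Lemma fcoeff_varM m i j :
  fcoeff m (fvar k i * fvar k j) = (FMonom [:: i; j] == m)%:R.
Proof.
have -> : FMonom [:: i; j] = mmul (fmu i) (fmu j).
  by apply/eqP; rewrite fmonom_eq fmM !fmU.
by rewrite /fcoeff [_ * _]malgM_def fgmulUU mulr1 mcoeffU.
Qed.

Lemma free_deg1E (x : F) : free_deg 1 x -> x = \sum_i fcoeff (fmu i) x *: fvar k i.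
Proof.
move=> dx; apply: fcoeff_eq => m; rewrite linear_sum /=.
under eq_bigr do rewrite linearZ /= fcoeff_var.
case: (fdeg m =P 1%N) => [m1|m1].
  have [i ->] : exists i, m = fmu i.
    case: m m1 => -[|i [|? ?]] //= _; exists i.
    by apply/eqP; rewrite fmonom_eq fmU.
  rewrite (bigD1 i) //= eqxx mulr1 big1 ?addr0 // => j ji.
  by rewrite fmonom_eq !fmU eqseq_cons andbT (negbTE ji) mulr0.
rewrite big1 => [|i _]; last first.
  by case: eqP => [e|_]; rewrite ?mulr0 //; case: m1; rewrite -e fdegU.
by apply: mcoeff_outdom; apply/negP => /dx.
Qed.

Lemma free_ind (P : F -> Prop) :
  P 0 -> (forall a x y, P x -> P y -> P (a *: x + y)) -> P 1 ->
  (forall x y, P x -> P y -> P (x * y)) -> (forall i, P (fvar k i)) -> forall x, P x.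
Proof.
move=> P0 Plin P1 PM Pvar x.
have Pword (w : seq 'I_N) : P (<< FMonom w >> : F).
  elim: w => [|i w IH].
    have -> // : (<< FMonom [::] >> : F) = 1.
    by rewrite -fmoneE.
  have -> : (<< FMonom (i :: w) >> : F) = fvar k i * << FMonom w >>; last exact: PM.
  have -> : FMonom (i :: w) = mmul (fmu i) (FMonom w).
    by apply/eqP; rewrite fmonom_eq fmM fmU.
  by rewrite /fvar [RHS]malgM_def fgmulUU mulr1.
have -> : x = \sum_(m <- msupp (x : {malg k[{fmonom 'I_N}]})) fcoeff m x *: (<< m >> : F).
  rewrite [LHS]monalgE; apply: eq_bigr => m _; apply/malgP => m'.
  by rewrite [RHS]mcoeffZ !mcoeffU mulrnAr mulr1.
elim/big_ind: _ => // [y z Py Pz|[w] _]; first by rewrite -[y]scale1r; apply: Plin.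
by rewrite -[_ *: _]addr0; apply: Plin.
Qed.

End FreeCoeff.

Section FreeCoaction.
Variables (k : fieldType) (N : nat) (H : hopfAlgType k).
Local Notation F := (free_alg k N).
Variable rhoF : {linear F -> tensor F H}.
Hypothesis rhoF_coact : comodule_algebra rhoF.
Hypothesis rhoF_graded : preserves_grading (@free_deg k N) rhoF.

(** The [y_ij] in [rhoF (v_j) = \sum_i v_i (x) y_ij]. *)
Definition coeff_mx : 'M[H]_N :=
  \matrix_(i, j) tcoef (fcoeff (fmu i)) (rhoF (fvar k j)).

Lemma tcoef_var_sum (W : lmodType k) (x : 'I_N -> W) i :
  tcoef (fcoeff (fmu i)) (\sum_l fvar k l \ox x l) = x i.
Proof.
rewrite linear_sum (bigD1 i) //= tcoefE /= fcoeff_var eqxx scale1r.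
rewrite big1 ?addr0 // => l li.
by rewrite tcoefE /= fcoeff_var fmonom_eq !fmU eqseq_cons andbT (negbTE li) scale0r.
Qed.

Lemma coaction_var j : rhoF (fvar k j) = \sum_i fvar k i \ox coeff_mx i j.
Proof.
have dj : free_deg 1 (fvar k j).
  by move=> m; rewrite msuppU1 inE => /eqP ->; rewrite fdegU.
have [s [Hs e]] := rhoF_graded dj.
suff [x xE] : exists x : 'I_N -> H, rhoF (fvar k j) = \sum_i fvar k i \ox x i.
  by rewrite xE; apply: eq_bigr => i _; rewrite mxE xE tcoef_var_sum.
rewrite e; elim: s {e} Hs => [|[a h] s IH] Hs.
  exists (fun=> 0); rewrite big_nil big1 // => i _.
  by rewrite -(scale0r (0 : H)) tensZr scale0r.
rewrite big_cons; have [|x ->] := IH.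
  by move=> p ps; apply: Hs; rewrite inE ps orbT.
have [/= /free_deg1E aE _] := Hs (a, h) (mem_head _ _).
exists (fun i => fcoeff (fmu i) a *: h + x i).
rewrite {1}aE tens_suml -big_split; apply: eq_bigr => i _ /=.
by rewrite tensDr tensZl tensZr.
Qed.

Lemma coeff_mx_comatrix : comatrix (fun i j => coeff_mx i j).
Proof.
have [rhoA rho1 _] := rhoF_coact; move=> l j; split.
  have := congr1 (tcoef (fcoeff (fmu l))) (rhoA (fvar k j)).
  rewrite coaction_var.
  have -> : tassoc (tmap rhoF idfun (\sum_i fvar k i \ox coeff_mx i j)) =
      \sum_m fvar k m \ox (\sum_i coeff_mx m i \ox coeff_mx i j).
    rewrite linear_sum; under [in RHS]eq_bigr do rewrite tens_sumr.
    rewrite [RHS]exchange_big linear_sum; apply: eq_bigr => i _ /=.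
    rewrite tmapE /= coaction_var tens_suml linear_sum.
    by apply: eq_bigr => m _; rewrite /= tassocE.
  have -> : tmap idfun comul (\sum_i fvar k i \ox coeff_mx i j) =
      \sum_i fvar k i \ox comul (coeff_mx i j).
    by rewrite linear_sum; apply: eq_bigr => i _; rewrite /= tmapE.
  by rewrite !tcoef_var_sum.
have := congr1 (fcoeff (fmu l)) (rho1 (fvar k j)).
rewrite coaction_var tlift_sum; last first.
  split=> [u a x y|u a x y] /=; first by rewrite scalerDr !scalerA mulrC.
  by rewrite linearP /= scalerDl scalerA.
rewrite linear_sum (bigD1 l) //= big1 => [|i il].
  rewrite linearZ /= !fcoeff_var eqxx mulr1 addr0 => ->.
  by rewrite fmonom_eq !fmU eqseq_cons andbT eq_sym.
by rewrite linearZ /= fcoeff_var fmonom_eq !fmU eqseq_cons andbT (negbTE il) mulr0.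
Qed.

Variables (E : 'M[k]_N) (Dinv : H).
Hypothesis rho_rel : rhoF (quad_rel E) = quad_rel E \ox Dinv.

(** The coefficients of the word [v_a v_b] on both sides of [rhoF r = r (x) D^-1]. *)
Lemma coeff_mx_rel :
  coeff_mx *m emb H E *m coeff_mx^T = emb H E *m Dinv%:M.
Proof.
have [_ _ [_ rhoM]] := rhoF_coact.
have coeff2 (a b i j : 'I_N) (h : H) :
    tcoef (fcoeff (FMonom [:: a; b])) ((fvar k i * fvar k j) \ox h) =
    if (i == a) && (j == b) then h else 0.
  rewrite tcoefE /= fcoeff_varM fmonom_eq !eqseq_cons andbT.
  by case: ifP; rewrite ?scale1r ?scale0r.
have coeff2_sum (a b : 'I_N) (x : 'I_N -> 'I_N -> H) :
    \sum_i \sum_j (if (i == a) && (j == b) then x i j else 0) = x a b.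
  rewrite (bigD1 a) //= [X in _ + X]big1 ?addr0 => [|i ia]; last first.
    by rewrite big1 // => j _; rewrite (negbTE ia).
  by rewrite (bigD1 b) //= !eqxx big1 ?addr0 // => j /negbTE ->; rewrite andbF.
apply/matrixP => a b; rewrite mul_scalarE embE -scalerAl mul1r.
have := congr1 (tcoef (fcoeff (FMonom [:: a; b]))) rho_rel.
have -> : quad_rel E \ox Dinv =
    \sum_i \sum_j (fvar k i * fvar k j) \ox (E i j *: Dinv).
  rewrite tens_suml; apply: eq_bigr => i _; rewrite tens_suml.
  by apply: eq_bigr => j _; rewrite tensZl tensZr.
have -> : tcoef (fcoeff (FMonom [:: a; b]))
    (\sum_i \sum_j (fvar k i * fvar k j) \ox (E i j *: Dinv)) = E a b *: Dinv.
  rewrite -[RHS](coeff2_sum a b (fun i j => E i j *: Dinv)) linear_sum.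
  apply: eq_bigr => i _; rewrite linear_sum.
  by apply: eq_bigr => j _; rewrite -coeff2.
move=> <-; rewrite /quad_rel linear_sum linear_sum mxE.
under eq_bigr => j _ do rewrite mulmx_embE mxE mulr_suml.
rewrite exchange_big; apply: eq_bigr => i _.
rewrite linear_sum linear_sum; apply: eq_bigr => j _ /=.
rewrite linearZ linearZ /= rhoM !coaction_var -scalerAl; congr (_ *: _).
rewrite -[LHS](coeff2_sum a b (fun c d => coeff_mx c i * coeff_mx d j)).
rewrite mulr_suml linear_sum; apply: eq_bigr => c _.
rewrite mulr_sumr linear_sum; apply: eq_bigr => d _ /=.
by rewrite tensM coeff2.
Qed.

Lemma tens_subM (A : algType k) (B : set H) :
  (forall x y, B x -> B y -> B (x * y)) -> forall s t : tensor A H,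
  tens_sub setT B s -> tens_sub setT B t -> tens_sub setT B (s * t).
Proof.
move=> BM s t [u [Hu ->]] [v [Hv ->]]; rewrite mulr_suml big_seq.
apply: tens_sub_sum => p /Hu[_ Bp]; rewrite mulr_sumr big_seq.
apply: tens_sub_sum => p' /Hv[_ Bp']; rewrite tensM.
by apply: tens_sub_tens => //; apply: BM.
Qed.

Lemma coaction_sub (B : set H) : hopf_subalgebra B -> (forall i j, B (coeff_mx i j)) ->
  forall x, tens_sub setT B (rhoF x).
Proof.
move=> [B1 Blin BM _ _] BY; have [_ _ [rho1 rhoM]] := rhoF_coact.
apply: free_ind => [|a x y Bx By||x y Bx By|i].
- by rewrite linear0; apply: tens_sub0.
- by rewrite linearP; apply: tens_subD => //; apply: tens_subZ.
- by rewrite rho1; apply: tens_sub_tens.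
- by rewrite rhoM; apply: tens_subM.
by rewrite coaction_var; apply: tens_sub_sum => j _; apply: tens_sub_tens.
Qed.

End FreeCoaction.

(** * The coaction on the quadratic algebra *)

Lemma coaction_AE_sub (k : fieldType) (N : nat) (E : 'M[k]_N) (H : hopfAlgType k)
    (rho : {linear AE E -> tensor (AE E) H})
    (rhoF : {linear free_alg k N -> tensor (free_alg k N) H}) (B : set H) :
  (forall x, rho (AE_pi E x) = tmap (AE_pi E) idfun (rhoF x)) ->
  (forall x, tens_sub setT B (rhoF x)) -> (range rho `<=` tens_sub setT B)%classic.
Proof.
move=> rhoE rhoB _ [a _ <-]; rewrite -[a]AE_reprK rhoE.
have [s [Hs ->]] := rhoB (mquot_repr a); rewrite linear_sum big_seq.
apply: tens_sub_sum => p /Hs[_ Bp]; rewrite /= tmapE.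
by apply: tens_sub_tens.
Qed.

Lemma iter_mul_id (T : Type) (f : T -> T) m n :
  (forall x, iter m f x = x) -> forall x, iter (n * m) f x = x.
Proof. by move=> fm x; elim: n => // n IH; rewrite mulSn iterD IH. Qed.

(** Take [j = 1] in the first case, and in the second one the product of [m] with the
    order of the antipode. *)
Lemma common_exponent (k : fieldType) (H : hopfAlgType k) (D : H) s (q : 'I_s -> k) :
  antipode_finite_order H ->
  [/\ distinct_with_inverses q, involutory H & central D]
  \/ ((forall e : nat, (0 < e)%N -> distinct_with_inverses (fun i => q i ^+ e))
      /\ exists2 m : nat, (0 < m)%N & central (D ^+ m)) ->
  exists2 j, (0 < j)%N &
    [/\ distinct_with_inverses (fun i => q i ^+ j),
        forall h : H, iter j.*2 antipode h = h & central (D ^+ j)].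
Proof.
move=> [m0 m0_gt0 S_m0] [[q_dist H_inv D_c]|[q_dist [m m_gt0 D_c]]].
  by exists 1%N; rewrite ?expr1.
exists (m * m0)%N; rewrite ?muln_gt0 ?m_gt0 //; split.
- by apply: q_dist; rewrite muln_gt0 m_gt0.
- by move=> h; rewrite -mul2n mulnA; apply: iter_mul_id.
rewrite exprM; elim: (m0) => [|n IH] h; first by rewrite expr0 mul1r mulr1.
by rewrite exprS -mulrA IH mulrA D_c mulrA.
Qed.

Theorem corollary5p15
    (k : closedFieldType) (k_char0 : [pchar k] =i pred0)
    (N : nat) (N_ge2 : (2 <= N)%N)
    (E : 'M[k]_N) (E_unit : E \in unitmx)
    (H : hopfAlgType k) (H_fin : antipode_finite_order H)
    (rho : {linear AE E -> tensor (AE E) H})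
    (rho_coact : comodule_algebra rho)
    (rho_faithful : inner_faithful rho)
    (rho_graded : preserves_grading (AE_deg E) rho)
    (D : H) (D_codet : homological_codeterminant rho D)
    (s : nat) (r : 'I_s -> nat) (q : 'I_s -> k)
    (r_gt0 : forall i, (0 < r i)%N)
    (q_neq : forall i, q i != 0 /\ q i != (-1) ^+ (r i).+1)
    (E_form :
       (exists (n : nat) (eN : (n + \sum_(i < s) (r i + r i))%N = N),
          (0 < n)%N /\ congruent E (castmx (eN, eN) (JDsum_mx n r q)))
       \/
       (exists eN : (\sum_(i < s) (r i + r i))%N = N,
          congruent E (castmx (eN, eN) (Dsum_mx r q))))
    (H_cond :
       [/\ distinct_with_inverses q, involutory H & central D]
       \/
       ((forall e : nat, (0 < e)%N ->
           distinct_with_inverses (fun i => q i ^+ e))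
        /\ exists2 m : nat, (0 < m)%N & central (D ^+ m))) :
  cocommutative H /\ (finite_dimensional H -> is_group_algebra H).
Proof.
have [rhoF [rhoF_coact rhoF_graded rhoE D_gl [Dinv [DDinv DinvD rho_rel]]]] := D_codet.
pose Y := coeff_mx rhoF.
have cY : comatrix (fun i j => Y i j) by apply: coeff_mx_comatrix.
have rhoY (B : set H) : hopf_subalgebra B -> (forall i j, B (Y i j)) ->
    (range rho `<=` tens_sub setT B)%classic.
  by move=> hB BY; apply: coaction_AE_sub rhoE _; apply: coaction_sub.
have SM : forall x y : H, antipode (x * y) = antipode y * antipode x.
  exact: (antipodeM rho_faithful cY rhoY).
have [j j_gt0 [q_dist Sj Dj]] := common_exponent H_fin H_cond.
have [T [lam [c [spec lam_inj]]]] :=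
  canonical_spectrum (natr_neq0 k_char0 (isT : (0 < 2)%N)) r_gt0 q_dist E_form.
have M_nonderog :=
  nonderogatory_cosquareX (natr_neq0 k_char0 j_gt0) E_unit spec lam_inj.
have YM := coeff_cosquare_comm E_unit cY SM D_gl DDinv DinvD
  (coeff_mx_rel rhoF_coact rhoF_graded rho_rel) Sj Dj.
split.
  exact: (cocommutative_gen rho_faithful cY rhoY (coeff_cocommutative M_nonderog cY YM)).
move=> H_fd; apply: group_like_span_group_algebra => // h.
pose G (x : H) : Prop := x \in lin_span (@group_like k H).
apply: (inner_faithful_ind rho_faithful cY rhoY (P := G)); rewrite /G.
- exact: rpred0.
- by move=> a x y Gx Gy; rewrite rpredD // rpredZ.
- exact/lin_span_gen/group_like1.
- exact: group_like_spanM.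
- by move=> J Z _ GZ a b; apply: group_like_span_antipode.
apply: (coeff_in_submodule M_nonderog cY YM (P := G)).
- exact: rpred0.
- by move=> a x y Gx Gy; rewrite /G rpredD // rpredZ.
move=> m y t dy tm; rewrite /G.
have [gl0 y0] := divided_sequence_trivial H_fd k_char0 dy.
by case: t tm => [_|t tm]; [apply: lin_span_gen|rewrite y0 ?rpred0].
Qed.
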